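(* Let $P(x)$ be an $m \times m$ homogeneous polynomial matrix in $x\in\mathbb{R}^n$ whose sparsity graph is chordal and has maximal cliques $\mathcal{C}_1,\ldots,\mathcal{C}_t$. If $P$ is strictly positive definite on $\mathbb{R}^n \setminus\{0\}$, then there exist an integer $\nu \geq 0$ and homogeneous SOS matrices $S_{k}(x)$ of size $|\mathcal{C}_k| \times |\mathcal{C}_k|$, $k=1,\ldots,t$, such that $$\|x\|^{2\nu} P(x) = \sum_{k=1}^t E_{\mathcal{C}_k}^{\mathsf T} S_{k}(x) E_{\mathcal{C}_k}.$$
   Context: Polynomials have real coefficients and variables $x=(x_1,\ldots,x_n)$; $\|x\|^2=x_1^2+\cdots+x_n^2$. An $m\times m$ polynomial matrix $P$ is a symmetric matrix with polynomial entries; it is homogeneous if all its entries are homogeneous of the same degree (the zero polynomial counts as homogeneous of every degree). Its sparsity graph is the undirected graph with vertices $\{1,\ldots,m\}$ and edge set $\mathcal{E}$ such that, for $i\ne j$, $(i,j)\notin\mathcal{E}$ if and only if $P_{ij}\equiv 0$. A clique is a set of vertices that are pairwise connected by edges; it is maximal if not contained in any other clique. A graph is chordal if every cycle of length at least $4$ has a chord (an edge joining two nonconsecutive vertices of the cycle). For a clique $\mathcal{C}$, with elements listed as $\mathcal{C}(1),\ldots,\mathcal{C}(|\mathcal{C}|)$ in increasing order, $E_{\mathcal{C}}\in\mathbb{R}^{|\mathcal{C}|\times m}$ is the matrix with $(E_{\mathcal{C}})_{ij}=1$ if $\mathcal{C}(i)=j$ and $0$ otherwise. A polynomial matrix $S(x)$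 is SOS if $S(x)=H(x)^{\mathsf T}H(x)$ for some (possibly rectangular) polynomial matrix $H(x)$. *)

(* Defs.v *)
From HB Require Import structures.
From mathcomp Require Import all_boot all_order all_algebra.
From mathcomp Require Import reals mpoly.

Set Implicit Arguments.
Unset Strict Implicit.
Unset Printing Implicit Defensive.

Import Order.TTheory GRing.Theory Num.Theory.

Local Open Scope ring_scope.

Section Graphs.
Variable (T : finType).
Implicit Types (e : rel T) (A : {set T}).

Definition is_clique e A : bool :=
  [forall x in A, forall y in A, (x != y) ==> e x y].

Definition maximal_clique e A : bool := maxset (is_clique e) A.

(* A cycle is a cyclic sequence of distinct vertices (ucycle); a chord is an
   edge between two of its vertices, neither of which is the cyclic successor
   of the other. *)
Definition chordal e : Prop :=
  forall c : seq T, ucycle e c -> (4 <= size c)%N ->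
  exists x y : T,
    [&& x \in c, y \in c, x != y, y != next c x, x != next c y & e x y].

End Graphs.

(* enum_val lists the elements of C : {set 'I_m} in increasing order. *)
Definition clique_mx (R : nzRingType) (m : nat) (C : {set 'I_m}) :
    'M[R]_(#|C|, m) :=
  \matrix_(i < #|C|, j < m) (enum_val i == j)%:R.

Section PolynomialMatrices.
Variables (R : realType) (n : nat).

Definition sparsity_graph (m : nat) (P : 'M[{mpoly R[n]}]_m) : rel 'I_m :=
  fun i j => (i != j) && (P i j != 0).

(* 0 \is d.-homog holds for every d. *)
Definition homog_mx (m : nat) (P : 'M[{mpoly R[n]}]_m) : Prop :=
  exists d : nat, forall i j : 'I_m, P i j \is d.-homog.

Definition eval_mx (m : nat) (P : 'M[{mpoly R[n]}]_m) (x : 'rV[R]_n) :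
    'M[R]_m :=
  map_mx (meval (x ord0)) P.

Definition posdef (m : nat) (A : 'M[R]_m) : Prop :=
  A^T = A /\ forall v : 'cV[R]_m, v != 0 -> 0 < (v^T *m A *m v) ord0 ord0.

Definition sos_mx (m : nat) (S : 'M[{mpoly R[n]}]_m) : Prop :=
  exists (p : nat) (H : 'M[{mpoly R[n]}]_(p, m)), S = H^T *m H.

Definition sqnorm_mpoly : {mpoly R[n]} := \sum_(i < n) 'X_i ^+ 2.

End PolynomialMatrices.

Arguments sqnorm_mpoly : clear implicits.

(* Main.v *)
(* For [p] homogeneous of degree [2 d] and a Gaussian vector [a], integration by
   parts gives
     E [H_p (a) (a . x)^(2 N)] = c p (x) ||x||^(2 (N - d)),    c > 0,
   where [H_p = exp (- Laplacian / 2) p] is the Hermite polynomial of [p].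
   Multiplying the term of degree [2 d - 2 j] of [H_p] by [||a||^(2 j)] only
   rescales its mean by an explicit factor of order [N^j]; dividing by these
   factors yields a form [q_N] of degree [2 d], linear in [p], with the same
   mean and with [q_N -> p] as [N] grows.  A Gaussian quadrature replaces [E] by
   a finite sum with nonnegative weights; with [Q_N] the image of [P] under
   [p |-> q_N],
     ||x||^(2 (N - d)) P (x) = sum_g w_g Q_N (a_g) (a_g . x)^(2 N).
   By compactness the real matrices [Q_N (a_g)] are positive semidefinite for
   [N] large, and they vanish wherever [P] does.  Hence each of them splits
   along the cliques of the chordal graph, by Cholesky elimination of
   simplicial vertices. *)
From HB Require Import structures.
Require Import Defs.
From mathcomp Require Import all_boot all_order all_algebra.
From mathcomp Require Import reals.
From mathcomp Require Import zify ring lra.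
From mathcomp Require boolp classical_sets topology normedtype derive complex.

Set Implicit Arguments.
Unset Strict Implicit.
Unset Printing Implicit Defensive.

Import Order.TTheory GRing.Theory Num.Theory.

Local Open Scope ring_scope.

(** * Chordal graphs *)

Section Chordal.
Variables (T : finType) (e : rel T).
Hypotheses (esym : symmetric e) (eirr : irreflexive e) (echordal : chordal e).

Definition simplicial (V : {set T}) (v : T) : bool :=
  [forall a in V, forall b in V, e v a ==> e v b ==> (a != b) ==> e a b].

Lemma last_take_nth (x0 x : T) (q : seq T) (i : nat) :
  (i <= size q)%N -> last x (take i q) = nth x0 (x :: q) i.
Proof. by elim: q x i => [|y q IH] x [|i] //=; exact: IH. Qed.

(** Position [i] is counted in [x :: q] but [j] in [q], so the edge skips the entries of [q] from
    index [i] to [j - 1], and none when [i = j]. *)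
Lemma path_shortcut (x : T) (q : seq T) (i j : nat) :
  (i <= j < size q)%N -> path e x q ->
  e (nth x (x :: q) i) (nth x q j) -> path e x (take i q ++ drop j q).
Proof.
case/andP=> ij jq pq ab; have iq := leq_trans ij (ltnW jq).
rewrite cat_path take_path //= (last_take_nth x) // (drop_nth x) //= ab /=.
move: pq; rewrite -{1}(cat_take_drop j q) cat_path => /andP[_].
by rewrite (drop_nth x) //= => /andP[].
Qed.

(* Otherwise [v :: x :: q] is a cycle whose chord shortens [q], because [v] is
   joined to no vertex of [C]. *)
Lemma detour_adjacent (C : {set T}) (v x y : T) (q : seq T) :
  v \notin C -> x \notin C -> {in C, forall c, ~~ e v c} ->
  e v x -> e v y -> x != y ->
  path e x q -> last x q = y -> {subset q <= y |: C} -> e x y.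
Proof.
move=> vC xC vNC vx vy xy.
have [k] := ubnP (size q); elim: k q => // k IH q /ltnSE qk pq.
case/shortenP: pq => p pp up sub yE qC.
have pk : (size p <= k)%N.
  by apply: leq_trans qk; apply: uniq_leq_size => //; case/andP: up.
have {sub} pC z : z \in p -> z \in y |: C by move/sub/qC.
have vx' : v != x by apply: contraTneq vx => ->; rewrite eirr.
have vy' : v != y by apply: contraTneq vy => ->; rewrite eirr.
have vp : v \notin p by apply/negP => /pC; rewrite !inE (negPf vy') (negPf vC).
case: p => [|p0 [|p1 p']] in pp up yE pk pC vp *.
- by rewrite -yE eqxx in xy.
- by move: pp yE => /=; rewrite andbT => xp0 <-.
have p2 : (1 < size [:: p0, p1 & p'])%N by [].
set p := [:: p0, p1 & p'] in p2 pp up yE pk pC vp *; clearbody p.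
pose c := v :: x :: p.
have uc : uniq c by rewrite /c cons_uniq inE negb_or vx' vp up.
have cyc : ucycle e c.
  apply/andP; split=> //; rewrite /c /cycle rcons_path; apply/andP; split.
    exact/andP.
  by rewrite [last _ _]yE esym.
have chord a b : a \in c -> b \in c -> (index a c < index b c)%N ->
    b != next c a -> a != next c b -> e a b -> e x y.
  move=> ac bc ab; rewrite !next_nth ac bc /c.
  have [i Di] : exists i, index a c = i by exists (index a c).
  have [j Dj] : exists j, index b c = j by exists (index b c).
  move: ac bc ab; rewrite -!index_mem Di Dj => ic jc ij.
  have Da : nth x c i = a by rewrite -Di nth_index // -index_mem Di.
  have Db : nth x c j = b by rewrite -Dj nth_index // -index_mem Dj.
  case: j => [|j] // in Dj ij jc Db *; rewrite ltnS in ij.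
  have {}jc : (j < (size p).+1)%N by [].
  move: Db; rewrite /c [nth _ _ _]/= => Db.
  (* A chord at [v] cannot end in [C], so it ends in [x] or [y]; these are the cyclic neighbours of
     [v], which a chord avoids. *)
  case: i => [|i] in Di ij ic Da *.
    move: Da => /= <-; case: j => [|j] in Dj ij jc Db *.
      by rewrite -Db /= eqxx.
    rewrite [nth _ _ _]/= in Db; move=> _ nb vb.
    have /pC : b \in p by rewrite -Db mem_nth.
    rewrite !inE => /orP[/eqP byE|/vNC]; last by rewrite vb.
    have jE : j.+1 = size p.
      have yl : index y (x :: p) = size p by rewrite -yE index_last.
      by rewrite -yl -byE -Db -[nth x p j]/(nth x (x :: p) j.+1) index_uniq.
    by rewrite jE nth_default //= eqxx in nb.
  (* Both ends lie on [x :: p] and are not consecutive, so the chord yields a strictly shorter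
     detour, to which [IH] applies. *)
  move: Da; rewrite /c [nth _ _ _]/= => Da nab _ eab.
  have {nab} ij' : (i.+1 < j)%N.
    rewrite ltn_neqAle ij andbT; apply: contra nab => /eqP ji.
    by rewrite -Db -ji (set_nth_default x) // ji.
  case: j => [|j] // in Dj ij ij' jc Db *; rewrite !ltnS in ij' jc.
  have ijp : (i <= j < size p)%N by rewrite (ltnW ij').
  apply: (IH (take i p ++ drop j p)).
  - rewrite size_cat size_take size_drop; move: ij' jc pk; case: (ltnP i (size p)) => /=; lia.
  - by apply: path_shortcut => //; rewrite Da -[nth x p j]/(nth x (x :: p) j.+1) Db.
  - by rewrite -yE -[in RHS](cat_take_drop j p) !last_cat (drop_nth x).
  - by move=> z; rewrite mem_cat => /orP[/mem_take|/mem_drop]; exact: pC.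
have [a [b /and5P[ac bc ab nba /andP[nab eab]]]] := echordal cyc p2.
case: (ltngtP (index a c) (index b c)) => [lt|gt|eq].
- exact: chord eab.
- by apply: (chord b a) => //; rewrite esym.
- by move: ab; rewrite -(nth_index x ac) eq nth_index ?eqxx.
Qed.

Definition universal (V : {set T}) (v : T) : bool :=
  [forall a in V, (a != v) ==> e v a].

Lemma not_universalP (V : {set T}) (v : T) :
  reflect (exists a, [/\ a \in V, a != v & ~~ e v a]) (~~ universal V v).
Proof.
rewrite negb_forall; apply: (iffP existsP) => -[a].
  by rewrite !negb_imply => /and3P[]; exists a.
by case=> aV av va; exists a; rewrite !negb_imply aV av.
Qed.

Lemma universalP (V : {set T}) (v : T) :
  reflect {in V, forall a, a != v -> e v a} (universal V v).
Proof.
apply: (iffP forall_inP) => [uV a aV av|uV a aV]; last exact/implyP/uV.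
by have /implyP := uV a aV; apply.
Qed.

Lemma simplicialP (V : {set T}) (v : T) :
  reflect {in V &, forall a b, e v a -> e v b -> a != b -> e a b}
          (simplicial V v).
Proof.
apply: (iffP forall_inP) => [sV a b aV bV va vb ab|sV a aV].
  have /forall_inP/(_ b bV) := sV a aV.
  by rewrite va vb ab.
by apply/forall_inP => b bV; do 3!apply/implyP => ?; exact: sV.
Qed.

Lemma universal_simplicial (V : {set T}) (v : T) :
  {in V, forall a, universal V a} -> simplicial V v.
Proof.
move=> uV; apply/simplicialP => a b aV bV _ _ ab.
by apply: (universalP _ _ (uV a aV)) => //; rewrite eq_sym.
Qed.

(* Dirac's argument: a component [C] of the non-neighbours of [v] is bordered
   by a clique [S], and a simplicial vertex of [C :|: S] found inside [C] is
   simplicial in [V]. *)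
Lemma exists_simplicial_nonadjacent (V : {set T}) (v : T) :
  v \in V -> ~~ universal V v ->
  exists s, [/\ s \in V, s != v, ~~ e v s & simplicial V s].
Proof.
have [k] := ubnP #|V|; elim: k V v => // k IH V v /ltnSE Vk vV.
case/not_universalP=> u [uV uv vu].
pose W := [set a in V | (a != v) && ~~ e v a].
pose r := [rel a b | [&& e a b, a \in W & b \in W]].
pose C := [set c | connect r u c].
pose S := [set s in V :\: C | [exists c in C, e s c]].
have uW : u \in W by rewrite inE uV uv.
have CW c : c \in C -> c \in W.
  rewrite inE => /connectP[p]; elim/last_ind: p => [_ -> //|p z _].
  by rewrite rcons_path last_rcons => /andP[_ /and3P[_ _ zW]] ->.
have CV c : c \in C -> c \in V by move/CW; rewrite inE => /andP[].
have vNC : {in C, forall c, ~~ e v c} by move=> c /CW; rewrite inE => /and3P[].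
have vC : v \notin C by apply/negP => /CW; rewrite inE eqxx /= andbF.
have rC a b : a \in C -> b \in W -> e a b -> b \in C.
  move=> aC bW ab; move: (aC); rewrite !inE => /connect_trans; apply.
  by apply: connect1; rewrite /= ab bW CW.
have SP s : s \in S -> [/\ s \in V, s \notin C, e v s & exists2 c, c \in C & e s c].
  rewrite in_set => /andP[/setDP[sV sC] /exists_inP[c cC sc]].
  split=> //; last by exists c.
  apply: contraNT sC => vs; apply: (rC c) => //; last by rewrite esym.
  rewrite inE sV vs andbT; apply: contraTneq sc => ->; exact: vNC.
have rsym : symmetric r by move=> a b; rewrite /= esym [(a \in W) && _]andbC.
have Sclique x y : x \in S -> y \in S -> x != y -> e x y.
  move=> /SP[_ xC vx [c cC xc]] /SP[_ yC vy [d dC yd]] xy.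
  (* Each border vertex has a neighbour in the connected set [C], so two of them are joined by a
     detour through [C]. *)
  have /connectP[q pq qd] : connect r c d.
    apply: (@connect_trans _ _ u); last by rewrite inE in dC.
    by rewrite (sym_connect_sym rsym); rewrite inE in cC.
  have qC : {subset c :: q <= C}.
    move=> z /(path_connect pq) cz; rewrite inE; rewrite inE in cC.
    exact: connect_trans cC cz.
  apply: (@detour_adjacent C v x y (c :: rcons q y)) => //.
  - rewrite /= xc rcons_path -qd esym yd andbT.
    by apply: sub_path pq => a b /and3P[].
  - by rewrite /= last_rcons.
  - move=> z; rewrite -rcons_cons mem_rcons !inE => /orP[->//|zq].
    by have := qC z zq; rewrite inE => ->; rewrite orbT.
pose V' := C :|: S.
have sV' : V' \subset V :\ v.
  apply/subsetP => z; rewrite in_setU in_setD1 => /orP[zC|/SP[zV zC vz _]].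
    by rewrite CV // andbT; apply: contraNneq vC => <-.
  by rewrite zV andbT; apply: contraTneq vz => ->; rewrite eirr.
have V'k : (#|V'| < k)%N.
  apply: leq_trans Vk; rewrite (cardsD1 v V) vV ltnS; exact: subset_leq_card.
have V'P z : z \in V' -> z \notin C -> z \in S by rewrite inE => /orP[->|].
(* All neighbours in [V] of a vertex of [C] lie in [V'], by the choice of [S]; hence being
   simplicial in [V'] suffices. *)
suff [s sC sV's] : exists2 s, s \in C & simplicial V' s.
  have nb a : a \in V -> e s a -> a \in V'.
    move=> aV sa; rewrite inE; case: (boolP (a \in C)) => //= aC.
    by rewrite inE inE aC aV; apply/existsP; exists s; rewrite sC esym.
  move: (CW _ sC); rewrite inE => /and3P[sV sv vs]; exists s; split=> //.
  apply/simplicialP => a b aV bV sa sb.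
  by apply: (simplicialP _ _ sV's) => //; exact: nb.
(* A vertex not adjacent to some [z] in the clique [S] lies outside [S], hence in [C]. *)
have [/existsP[z /andP[zS zu]]|] := boolP [exists z in S, ~~ universal V' z].
  have zV' : z \in V' by rewrite inE zS orbT.
  have [s [s_V' sz zs ss]] := IH _ _ V'k zV' zu.
  exists s => //; apply: contraNT zs => /(V'P _ s_V') sS.
  by apply: Sclique => //; rewrite eq_sym.
rewrite negb_exists => /forallP Suniv.
have {}Suniv z : z \in S -> universal V' z.
  by move=> zS; have := Suniv z; rewrite zS negbK.
(* Border vertices are now adjacent to all of [V'], so a vertex not adjacent to [z] is again in
   [C]. *)
have [/existsP[z /andP[zC zu]]|] := boolP [exists z in C, ~~ universal V' z].
  have zV' : z \in V' by rewrite inE zC.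
  have [s [s_V' sz zs ss]] := IH _ _ V'k zV' zu.
  exists s => //; apply: contraNT zs => /(V'P _ s_V') /Suniv /universalP us.
  by rewrite esym us // eq_sym.
rewrite negb_exists => /forallP Cuniv.
(* Otherwise [V'] is a clique and any vertex of [C] will do. *)
exists u; first by rewrite inE connect0.
apply: universal_simplicial => z; rewrite inE => /orP[zC|/Suniv //].
by have := Cuniv z; rewrite zC negbK.
Qed.

Lemma exists_simplicial (V : {set T}) :
  V != set0 -> exists2 s, s \in V & simplicial V s.
Proof.
move=> /set0Pn[v vV].
have [/existsP[z /andP[zV zu]]|] := boolP [exists z in V, ~~ universal V z].
  by have [s [sV _ _ ss]] := exists_simplicial_nonadjacent zV zu; exists s.
rewrite negb_exists => /forallP Vuniv; exists v => //.
apply: universal_simplicial => z zV.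
by have := Vuniv z; rewrite zV negbK.
Qed.

End Chordal.

(** * Positive semidefinite matrices with a chordal pattern *)

Definition psd (R : realType) (m : nat) (A : 'M[R]_m) : Prop :=
  forall v : 'cV[R]_m, 0 <= (v^T *m A *m v) ord0 ord0.

Lemma quadratic_shift (R : realType) (m : nat) (A : 'M[R]_m) (s : 'I_m)
    (v : 'cV[R]_m) (t : R) : A^T = A ->
  let w := v + t *: delta_mx s ord0 in
  (w^T *m A *m w) ord0 ord0 =
    (v^T *m A *m v) ord0 ord0 + 2 * t * (A *m v) s ord0 + t ^+ 2 * A s s.
Proof.
move=> Asym w; pose d : 'cV[R]_m := delta_mx s ord0.
have dl (u : 'cV[R]_m) : (d^T *m u) ord0 ord0 = u s ord0.
  by rewrite trmx_delta -rowE mxE.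
have vd : (v^T *m A *m d) ord0 ord0 = (A *m v) s ord0.
  by rewrite -colE mxE -[A *m v]trmxK trmx_mul Asym [RHS]mxE.
have dd : (A *m d) s ord0 = A s s by rewrite -colE mxE.
have -> : w^T *m A *m w = v^T *m A *m v + t *: (v^T *m A *m d) +
    t *: (d^T *m (A *m v)) + t ^+ 2 *: (d^T *m (A *m d)).
  have -> : w^T = v^T + t *: d^T by apply/matrixP => i j; rewrite !mxE.
  rewrite /w -/d !mulmxDl !mulmxDr.
  by rewrite -!scalemxAl -!scalemxAr scalerA -!mulmxA expr2 !addrA.
have E (X Y : 'M[R]_1) : (X + Y) ord0 ord0 = X ord0 ord0 + Y ord0 ord0 by rewrite mxE.
have Z c (X : 'M[R]_1) : (c *: X) ord0 ord0 = c * X ord0 ord0 by rewrite mxE.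
by rewrite !E !Z vd !dl dd; ring.
Qed.

Lemma psd_diag_ge0 (R : realType) (m : nat) (A : 'M[R]_m) (s : 'I_m) :
  A^T = A -> psd A -> 0 <= A s s.
Proof.
move=> Asym /(_ (0 + 1 *: delta_mx s ord0)); rewrite quadratic_shift //.
by rewrite !mulmx0 !mxE mulr0 expr1n mul1r !add0r.
Qed.

(** With a zero diagonal entry the form is affine along the axis [s], and a nonnegative affine
    function has slope zero. *)
Lemma psd_row_eq0 (R : realType) (m : nat) (A : 'M[R]_m) (s j : 'I_m) :
  A^T = A -> psd A -> A s s = 0 -> A s j = 0.
Proof.
move=> Asym Apsd ss; apply/eqP/negPn/negP => sj.
(* The multiple of the axis vector is chosen to give the form the value [-1]. *)
have := Apsd (delta_mx j ord0 + (- (A j j + 1) / (2 * A s j)) *: delta_mx s ord0).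
rewrite quadratic_shift // ss mulr0 addr0 trmx_delta -rowE -colE -colE !mxE.
suff -> : 2 * (- (A j j + 1) / (2 * A s j)) * A s j = - (A j j + 1) by lra.
by field.
Qed.

(** The value of the Schur complement at [v] is the minimum of the original form over all shifts of
    [v] along the axis [s]; the shift used below attains it. *)
Lemma schur_complement_psd (R : realType) (m : nat) (A : 'M[R]_m) (s : 'I_m) :
  A^T = A -> psd A -> 0 < A s s ->
  psd (A - (A s s)^-1 *: (col s A *m row s A)).
Proof.
move=> Asym Apsd s0 v.
have := Apsd (v + (- (A s s)^-1 * (A *m v) s ord0) *: delta_mx s ord0).
rewrite quadratic_shift //.
have rv : (row s A *m v) ord0 ord0 = (A *m v) s ord0 by rewrite -row_mul mxE.
have cv : (v^T *m col s A) ord0 ord0 = (A *m v) s ord0.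
  by rewrite -rv -[_ *m col s A]trmxK mxE trmx_mul trmxK tr_col Asym.
have -> : (v^T *m (A - (A s s)^-1 *: (col s A *m row s A)) *m v) =
    v^T *m A *m v - (A s s)^-1 *: (v^T *m col s A *m (row s A *m v)).
  by rewrite mulmxBr mulmxBl -scalemxAr -scalemxAl !mulmxA.
have -> : (v^T *m A *m v - (A s s)^-1 *: (v^T *m col s A *m (row s A *m v))) ord0 ord0
  = (v^T *m A *m v) ord0 ord0 - (A s s)^-1 * (A *m v) s ord0 ^+ 2.
  by rewrite !mxE big_ord1 cv rv expr2 !mxE.
move=> le; apply: le_trans le _; rewrite le_eqVlt; apply/orP; left; apply/eqP.
by field; rewrite gt_eqF.
Qed.

(** * Cholesky factors whose columns are supported on cliques *)

Section ChordalFactorization.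
Variables (R : realType) (m : nat) (e : rel 'I_m).
Hypotheses (esym : symmetric e) (eirr : irreflexive e) (echordal : chordal e).

(** Eliminating a simplicial [s] creates off-diagonal entries only between its neighbours, which are
    already adjacent, so there is no fill-in. [V] holds the rows still to be eliminated, and each
    column of [L] is indexed by its pivot. *)
Lemma psd_chordal_factor_on (V : {set 'I_m}) (A : 'M[R]_m) :
  A^T = A -> psd A -> (forall i j, i != j -> A i j != 0 -> e i j) ->
  (forall i j, A i j != 0 -> i \in V) ->
  exists L : 'M[R]_m, [/\ A = L *m L^T, forall i k, L i k != 0 -> k \in V &
    forall k i j, i != j -> L i k != 0 -> L j k != 0 -> e i j].
Proof.
have [k] := ubnP #|V|; elim: k V A => // k IH V A /ltnSE Vk Asym Apsd Ae AV.
have AC i j : A i j = A j i by rewrite -[in LHS]Asym mxE.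
have [V0|/(exists_simplicial esym eirr echordal)[s sV /simplicialP ss]] := eqVneq V set0.
  exists 0; split=> [|i k0|k0 i j]; rewrite ?mxE ?eqxx // mul0mx.
  by apply/matrixP => i j; rewrite mxE; apply/eqP/negPn/negP => /AV; rewrite V0 inE.
have sVk : (#|V :\ s| < k)%N by apply: leq_trans Vk; rewrite (cardsD1 s V) sV.
have [s0|sn0] := eqVneq (A s s) 0.
  have [i j Aij|L [AL LV Le]] := IH (V :\ s) A sVk Asym Apsd Ae.
    rewrite in_setD1 (AV _ _ Aij) andbT; apply: contraNneq Aij => ->.
    by apply/eqP/psd_row_eq0.
  by exists L; split=> // i k0 /LV; rewrite in_setD1 => /andP[].
have sp : 0 < A s s by rewrite lt_def sn0 psd_diag_ge0.
pose A' := A - (A s s)^-1 *: (col s A *m row s A).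
have A'E i j : A' i j = A i j - A i s * A s j / A s s.
  by rewrite !mxE big_ord1 !mxE mulrC.
have A'nz i j : A' i j != 0 -> A i j != 0 \/ A i s != 0 /\ A s j != 0.
  rewrite A'E; have [->|] := eqVneq (A i j) 0; last by left.
  rewrite sub0r oppr_eq0 !mulf_eq0 !negb_or -andbA => /and3P[? ? _]; by right.
have A's j : A' s j = 0 by rewrite A'E mulrAC mulfV // mul1r subrr.
have A'sym : A'^T = A'.
  by apply/matrixP => i j; rewrite mxE !A'E AC (AC j s) (AC s i) [_ * A i s]mulrC.
have A'C i j : A' i j = A' j i by rewrite -[in LHS]A'sym mxE.
have clq i j : i != j -> A i s != 0 -> A j s != 0 -> e i j.
  move=> ij is_ js; have [E|si] := eqVneq i s.
    by rewrite E; apply: Ae; [rewrite -E|rewrite AC].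
  have [E|sj] := eqVneq j s; first by rewrite E; exact: Ae.
  apply: ss (AV _ _ is_) (AV _ _ js) _ _ ij; by apply: Ae; [rewrite eq_sym|rewrite AC].
have [|i j ij|i j A'ij|L [AL LV Le]] := IH (V :\ s) A' sVk A'sym.
- exact: schur_complement_psd.
- case/A'nz=> [|[is_ sj]]; first exact: Ae.
  by apply: clq => //; rewrite AC.
- rewrite in_setD1; apply/andP; split.
    by apply: contraNneq A'ij => ->; rewrite A's.
  by case: (A'nz _ _ A'ij) => [/AV|[/AV]].
(* Column [s] of the recursive factor is empty, hence free for the pivot column; after scaling, its
   outer product is the rank-one term subtracted in [A']. *)
have Ls i : L i s = 0 by apply/eqP/negPn/negP => /LV; rewrite in_setD1 eqxx.
exists (\matrix_(i, k) if k == s then A i s / Num.sqrt (A s s) else L i k).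
split=> [|i k0|k0 i j ij].
- apply/matrixP => i j; rewrite mxE (bigD1 s) //= !mxE eqxx.
  have -> : A i j = A i s * A s j / A s s + A' i j by rewrite A'E addrC subrK.
  congr (_ + _).
    by rewrite mulrACA -invfM -expr2 sqr_sqrtr ?ltW // (AC j).
  rewrite AL mxE (bigD1 s) //= Ls mul0r add0r.
  by apply: eq_bigr => k0 ks; rewrite !mxE (negPf ks).
- rewrite mxE; case: (k0 =P s) => [-> //|_ /LV]; by rewrite in_setD1 => /andP[].
- rewrite !mxE; case: (k0 =P s) => [_|_]; last exact: Le.
  by rewrite !mulf_eq0 !negb_or => /andP[is_ _] /andP[js _]; exact: clq.
Qed.

Lemma psd_chordal_factor (A : 'M[R]_m) :
  A^T = A -> psd A -> (forall i j, i != j -> A i j != 0 -> e i j) ->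
  exists L : 'M[R]_m, A = L *m L^T /\
    forall k i j, i != j -> L i k != 0 -> L j k != 0 -> e i j.
Proof.
move=> Asym Apsd Ae.
have [i j _|L [AL _ Le]] := @psd_chordal_factor_on [set: 'I_m] A Asym Apsd Ae.
  by rewrite inE.
by exists L.
Qed.

End ChordalFactorization.

(** * Gaussian quadrature *)

Module Quadrature.
Import complex.

Section HermiteJacobi.
Variables (R : rcfType) (m : nat).

(** Differentiation in the basis of normalized Hermite polynomials of degree at most [m]. *)
Definition lowering : 'M[R]_m.+1 :=
  \matrix_(i, j) (if (i.+1 == j :> nat) then Num.sqrt (j%:R) else 0).

(** Multiplication by the variable in that basis, compressed to degree at most [m]. *)
Definition jacobi : 'M[R]_m.+1 := lowering + lowering^T.

Lemma lowering_delta0 : lowering *m (delta_mx ord0 ord0 : 'cV_m.+1) = 0.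
Proof.
by rewrite -colE; apply/matrixP => i j; rewrite !mxE.
Qed.

(** The canonical commutation relation of differentiation and multiplication by the variable; the
    corner term is the effect of truncating at degree [m]. *)
Lemma lowering_commutator :
  lowering *m jacobi - jacobi *m lowering =
  1%:M - m.+1%:R *: delta_mx ord_max ord_max.
Proof.
rewrite /jacobi mulmxDr mulmxDl opprD addrACA subrr add0r.
apply/matrixP => i j; rewrite !mxE.
have S (a b : 'I_m.+1) : \sum_k lowering a k * lowering^T k b = 
  (a == b)%:R * (a < m)%:R * a.+1%:R.
  have [am|am] := ltnP a m.
    rewrite (bigD1 (inord a.+1)) //= !mxE inordK // eqxx eq_sym eqSS -val_eqE.
    rewrite big1 ?addr0 => [|k ka].
      case: eqP => /= _; last by rewrite mulr0 !mul0r.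
      by rewrite -expr2 sqr_sqrtr ?ler0n // mulr1 mul1r.
    rewrite !mxE [X in X * _]ifF ?mul0r //; apply: contraNF ka => /eqP ka.
    by rewrite -val_eqE /= inordK // -ka.
  rewrite mulr0 mul0r big1 // => k _; rewrite !mxE ifF ?mul0r //.
  by apply/eqP => ak; have := ltn_ord k; rewrite -ak ltnS ltnNge am.
have S' (a b : 'I_m.+1) : \sum_k lowering^T a k * lowering k b = (a == b)%:R * a%:R.
  case: a => -[|a] la.
    by rewrite mulr0 big1 // => k _; rewrite !mxE mul0r.
  rewrite (bigD1 (Ordinal (ltnW la))) //= !mxE eqxx -val_eqE /=.
  rewrite big1 ?addr0 => [|k ka].
    case: eqP => /= [<-|_]; last by rewrite mulr0 !mul0r.
    by rewrite -expr2 sqr_sqrtr ?ler0n // mul1r.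
  rewrite !mxE ifF ?mul0r //; apply: contraNF ka => /eqP [ka].
  by rewrite -val_eqE /= ka.
rewrite S S' -!val_eqE /=.
have [->|ij] := eqVneq (i : nat) j; last first.
  rewrite !mul0r subrr; case: eqP => [im|_] /=; last by rewrite mulr0 subrr.
  rewrite [X in _ * X%:R]ifF ?mulr0 ?subrr //.
  by apply: contraNF ij => /eqP ->; exact/eqP.
rewrite andbb; have [jm|] := ltnP j m.
  by rewrite (ltn_eqF jm) mulr0 !mul1r subr0 -natr1 [_ + 1]addrC addrK.
rewrite leq_eqVlt ltnNge -ltnS ltn_ord orbF => /eqP jm.
by rewrite -jm eqxx mulr0 mul0r mul1r mulr1 -natr1 sub0r opprD addrCA subrr addr0.
Qed.

(** For [k <= m], the coordinates of the monomial of degree [k]; the entry at [ord0] is its Gaussian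
    mean. *)
Definition hermite_vec (k : nat) : 'cV[R]_m.+1 :=
  iter k (mulmx jacobi) (delta_mx ord0 ord0).

Lemma hermite_vecS (k : nat) :
  hermite_vec k.+1 = jacobi *m hermite_vec k.
Proof. by []. Qed.

Lemma hermite_vec_support (k : nat) (i : 'I_m.+1) :
  (k < i)%N -> hermite_vec k i ord0 = 0.
Proof.
elim: k i => [|k IH] i ki.
  by rewrite mxE eqxx andbT -val_eqE /= gtn_eqF.
rewrite hermite_vecS mxE big1 // => j _.
have [kj|jk] := ltnP k j; first by rewrite IH ?mulr0.
rewrite !mxE !ifF ?addr0 ?mul0r //; apply/negbTE; rewrite neq_ltn; lia.
Qed.

Lemma lowering_hermite_vec (k : nat) : (k <= m)%N ->
  lowering *m hermite_vec k = k%:R *: hermite_vec k.-1.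
Proof.
elim: k => [_|k IH km]; first by rewrite scale0r lowering_delta0.
have E : lowering *m jacobi =
    jacobi *m lowering + (1%:M - m.+1%:R *: delta_mx ord_max ord_max).
  by rewrite -lowering_commutator addrC subrK.
rewrite hermite_vecS mulmxA E mulmxDl -mulmxA (IH (ltnW km)).
rewrite mulmxBl mul1mx -scalemxAl.
(* The truncation term reads only the top coordinate, which vanishes since [k < m]. *)
have -> : delta_mx ord_max ord_max *m hermite_vec k = 0 :> 'cV_m.+1.
  apply/matrixP => i j; rewrite mxE big1 ?mxE // => l _; rewrite mxE.
  have [->|] := eqVneq l ord_max; last by rewrite andbF mul0r.
  by rewrite ord1 hermite_vec_support ?mulr0.
rewrite scaler0 subr0 -scalemxAr -natr1 scalerDl scale1r; congr (_ + _).
by case: k {IH km} => [|k]; rewrite ?scale0r.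
Qed.

(** Row [ord0] of [lowering^T] is zero, so only differentiation contributes to this entry; at
    [k = 0] the factor [k] makes [k.-1] harmless. *)
Lemma hermite_moment (k : nat) : (k <= m)%N ->
  hermite_vec k.+1 ord0 ord0 = k%:R * hermite_vec k.-1 ord0 ord0.
Proof.
move=> km; rewrite hermite_vecS mulmxDl.
rewrite lowering_hermite_vec // mxE [X in X + _]mxE -[RHS]addr0; congr (_ + _).
by rewrite mxE big1 // => j _; rewrite !mxE mul0r.
Qed.

Lemma hermite_moment0 : hermite_vec 0 ord0 ord0 = 1.
Proof. by rewrite mxE eqxx. Qed.
End HermiteJacobi.

Local Open Scope complex_scope.
Lemma real_complex_real (R : rcfType) (x : R) : x%:C \is Num.real.
Proof. by rewrite realE -(rmorph0 (real_complex R)) !lecR -realE num_real. Qed.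

(* The nodes are the eigenvalues of the Jacobi matrix of the Hermite polynomials,
   the weights the squared first coordinates of its unit eigenvectors. *)
Lemma gauss_hermite_quadrature (R : rcfType) (K : nat) :
  exists (w t : 'I_K.+1 -> R), [/\ forall j, 0 <= w j, \sum_j w j = 1 &
    forall k, (k <= K)%N ->
      \sum_j w j * t j ^+ k.+1 = k%:R * \sum_j w j * t j ^+ k.-1].
Proof.
pose J := map_mx (real_complex R) (jacobi R K).
(* The matrix is diagonalized over the complex numbers; its eigenvalues are real because it is
   Hermitian, and the weights are squared moduli, so both come back to [R]. *)
have Jherm : J \is hermsymmx.
  apply/is_hermitianmxP; rewrite expr0 scale1r; apply/matrixP => i j.
  by rewrite !mxE /= (CrealP _) ?real_complex_real // addrC.
pose U := spectralmx J; pose d := spectral_diag J.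
have UU : U \is unitarymx := spectral_unitarymx J.
have JE : J = invmx U *m diag_mx d *m U.
  exact/orthomx_spectralP/hermitian_normalmx.
have dreal := hermitian_spectral_diag_real Jherm.
pose w j : R := complex.Re (`|U j ord0| ^+ 2); pose t j : R := complex.Re (d ord0 j).
have wE j : (w j)%:C = `|U j ord0| ^+ 2.
  by rewrite /w RRe_real // rpredX // normr_real.
have tE j : (t j)%:C = d ord0 j.
  by rewrite /t RRe_real //; exact: mxOverP.
(* In the eigenbasis each application of [J] multiplies by the nodes, so the entry at [ord0] becomes
   a weighted power sum. *)
have hE k : map_mx (real_complex R) (hermite_vec R K k) =
  invmx U *m (\col_j (d ord0 j ^+ k * U j ord0)).
  elim: k => [|k IH].
    have -> : \col_j (d ord0 j ^+ 0 * U j ord0) = U *m delta_mx ord0 ord0.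
      by rewrite -colE; apply/matrixP => i j; rewrite !mxE mul1r.
    by rewrite mulmxA mulVmx ?spectral_unit // mul1mx map_delta_mx.
  rewrite hermite_vecS map_mxM /= IH -/J {1}JE -!mulmxA mulKVmx ?spectral_unit //.
  congr (_ *m _); rewrite mul_diag_mx.
  by apply/matrixP => i j; rewrite !mxE exprS mulrA.
have mE k : hermite_vec R K k ord0 ord0 = \sum_j w j * t j ^+ k.
  apply: complexI; move/matrixP/(_ ord0 ord0): (hE k).
  rewrite mxE => ->; rewrite invmx_unitary // mxE rmorph_sum.
  apply: eq_bigr => j _; rewrite !mxE rmorphM rmorphXn /= wE tE normCK.
  by rewrite mulrCA [RHS]mulrC [U j ord0 * _]mulrC.
exists w, t; split=> [j||k kK].
- by rewrite -lecR wE exprn_ge0.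
- by rewrite -(hermite_moment0 R K) mE; apply: eq_bigr => j _; rewrite expr0 mulr1.
- by rewrite -!mE hermite_moment.
Qed.

End Quadrature.

(** * Polynomial functions on compact sets *)

Module Compactness.
Import boolp classical_sets topology normedtype derive.
Import numFieldNormedType.Exports.
Local Open Scope classical_set_scope.

(** An inductive presentation lets continuity and boundedness on the unit cube follow by structural
    induction. *)
Inductive polyfun (R : realType) (p : nat) : ('rV[R]_p -> R) -> Prop :=
| polyfun_cst c : polyfun (fun=> c)
| polyfun_coord i : polyfun (fun z => z ord0 i)
| polyfun_add f g : polyfun f -> polyfun g -> polyfun (fun z => f z + g z)
| polyfun_mul f g : polyfun f -> polyfun g -> polyfun (fun z => f z * g z).

Lemma polyfun_continuous (R : realType) (p : nat) (f : 'rV[R]_p -> R) :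
  polyfun f -> continuous f.
Proof.
elim=> [c|i|g h _ cg _ ch|g h _ cg _ ch].
- exact: cst_continuous.
- exact: coord_continuous.
- move=> z; exact: cvgD (cg z) (ch z).
- move=> z; exact: cvgM (cg z) (ch z).
Qed.

(** The extreme value theorem on a compact set. With [g] and [h] the squared norms of two blocks of
    coordinates, this set is a product of unit spheres. *)
Lemma box_level_min (R : realType) (p : nat) (f g h : 'rV[R]_p -> R) :
  polyfun f -> polyfun g -> polyfun h ->
  (forall z : 'rV[R]_p, (forall i, `|z ord0 i| <= 1) -> g z = 1 -> h z = 1 -> 0 < f z) ->
  exists2 d : R, 0 < d &
    forall z : 'rV[R]_p, (forall i, `|z ord0 i| <= 1) -> g z = 1 -> h z = 1 -> d <= f z.
Proof.
move=> /polyfun_continuous cf /polyfun_continuous cg /polyfun_continuous ch fpos.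
pose B := [set z : 'rV[R]_p | forall i, `[(-1 : R), 1] (z ord0 i)].
pose K := (g @^-1` [set x | x = 1] `&` h @^-1` [set x | x = 1]) `&` B.
have cB : compact B.
  apply: (@rV_compact R p (fun=> `[(-1 : R), 1])) => i; exact: segment_compact.
have KP z : K z <-> [/\ forall i, `|z ord0 i| <= 1, g z = 1 & h z = 1].
  split=> [[[gz hz] Bz]|[Bz gz hz]]; split=> // i.
  - by have := Bz i; rewrite /= in_itv/= ler_norml.
  - by rewrite /= in_itv/= -ler_norml.
have cK : compact K.
  apply: (subclosed_compact _ cB) => [|z []//].
  apply: closedI; first apply: closedI.
  - by apply: closed_comp => [z _|]; [exact: cg|exact: closed_eq].
  - by apply: closed_comp => [z _|]; [exact: ch|exact: closed_eq].
  - exact: compact_closed cB.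
have [K0|K0] := pselect (K !=set0); last first.
  exists 1 => // z Bz gz hz; case: K0; exists z; exact/KP.
have [|c cK' cmin] := @compact_EVT_min _ R f K K0 cK.
  exact/continuous_subspaceT.
exists (f c) => [|z Bz gz hz].
  by move: cK'; rewrite inE => /KP[]; exact: fpos.
by apply: cmin; rewrite inE; exact/KP.
Qed.
End Compactness.

From mathcomp Require Import mpoly.

(** * The Laplacian on homogeneous polynomials *)

Section HomogeneousPolynomials.
Variables (R : realType) (n : nat).
Implicit Types (p q : {mpoly R[n]}).

Lemma dhomog_ind (d : nat) (Pr : {mpoly R[n]} -> Prop) :
  Pr 0 -> (forall p q, Pr p -> Pr q -> Pr (p + q)) ->
  (forall c p, Pr p -> Pr (c *: p)) ->
  (forall m, mdeg m = d -> Pr 'X_[m]) ->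
  forall p, p \is d.-homog -> Pr p.
Proof.
move=> P0 PD PZ PX p /dhomogP hp; rewrite (mpolyE p) big_seq.
by apply: (big_ind Pr) => // m mp; apply/PZ/PX/hp.
Qed.

Lemma dhomog_msize_le (d : nat) p : p \is d.-homog -> (msize p <= d.+1)%N.
Proof.
move=> /dhomogP hp; rewrite msizeE big_seq.
by elim/big_ind: _ => [|a b|m /hp ->]; rewrite ?geq_max // => -> ->.
Qed.

Lemma dhomog_mderiv (d : nat) p i :
  p \is d.+1.-homog -> p^`M(i) \is d.-homog.
Proof.
move=> /dhomogP hp; apply/dhomogP => m; rewrite mcoeff_msupp mcoeff_mderiv => nz.
have : mdeg (m + U_(i))%MM = d.+1.
  by apply: hp; rewrite mcoeff_msupp; apply: contraNneq nz => ->; rewrite mul0rn.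
by rewrite mdegD mdeg1 addn1 => -[].
Qed.

Lemma mderiv_0homog p i : p \is 0.-homog -> p^`M(i) = 0.
Proof.
move: p; apply: dhomog_ind => [|p q hp hq|c p hp|m /eqP].
- by rewrite mderiv0.
- by rewrite mderivD hp hq addr0.
- by rewrite mderivZ hp scaler0.
- by rewrite mdeg_eq0 => /eqP ->; rewrite mpolyX0 mderivC.
Qed.

Lemma euler_identity (d : nat) p :
  p \is d.-homog -> \sum_i 'X_i * p^`M(i) = d%:R *: p.
Proof.
move: p; apply: dhomog_ind => [|p q hp hq|c p hp|m md].
- by rewrite scaler0 big1 // => i _; rewrite mderiv0 mulr0.
- by rewrite scalerDr -hp -hq -big_split; apply: eq_bigr => i _; rewrite mderivD mulrDr.
- rewrite scalerA mulrC -scalerA -hp scaler_sumr.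
  by apply: eq_bigr => i _; rewrite mderivZ scalerAr.
- rewrite -md mdegE natr_sum scaler_suml; apply: eq_bigr => i _.
  rewrite mderivX -scalerAr -mpolyXD; have [->|mi] := eqVneq (m i) 0%N.
    by rewrite !scale0r.
  by rewrite addmC submK // lep1mP.
Qed.

Lemma mderivXn p i (k : nat) : (p ^+ k.+1)^`M(i) = k.+1%:R *: (p^`M(i) * p ^+ k).
Proof.
elim: k => [|k IH]; first by rewrite expr1 expr0 mulr1 scale1r.
rewrite exprS mderivM IH -scalerAr [p * _]mulrCA -exprS -[in RHS]natr1 addrC.
by rewrite scalerDl scale1r.
Qed.

Definition lap p : {mpoly R[n]} := \sum_i p^`M(i)^`M(i).

Lemma lap_is_linear : linear lap.
Proof.
move=> c p q; rewrite /lap scaler_sumr -big_split; apply: eq_bigr => i _ /=.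
by rewrite mderivD mderivZ mderivD mderivZ.
Qed.
HB.instance Definition _ := GRing.isLinear.Build R {mpoly R[n]} {mpoly R[n]} _ lap
  lap_is_linear.

Lemma iter_lap_is_linear (j : nat) : linear (iter j lap).
Proof. by move=> c p q; elim: j => //= j ->; rewrite linearP. Qed.
HB.instance Definition _ (j : nat) := GRing.isLinear.Build R {mpoly R[n]} {mpoly R[n]}
  _ (iter j lap) (iter_lap_is_linear j).

Lemma lap_mderiv p i : lap p^`M(i) = (lap p)^`M(i).
Proof.
rewrite /lap raddf_sum; apply: eq_bigr => j _ /=.
by rewrite (mderiv_comm i j) (mderiv_comm i j).
Qed.

Lemma mderivXU i j : ('X_i : {mpoly R[n]})^`M(j) = (i == j)%:R.
Proof.
rewrite mderivX mnm1E; have [->|_] := eqVneq i j; last by rewrite scale0r.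
by rewrite scale1r -{1}[U_(j)%MM]add0m addmK mpolyX0.
Qed.

Lemma lap_mulX p i : lap ('X_i * p) = 'X_i * lap p + 2 *: p^`M(i).
Proof.
rewrite /lap mulr_sumr (bigD1 i) //= [in RHS](bigD1 i) //=.
rewrite -addrA [_ + 2 *: _]addrC addrA; congr (_ + _).
  rewrite mderivM mderivXU eqxx mul1r mderivD mderivM mderivXU eqxx mul1r.
  by rewrite addrA addrC scaler_nat.
apply: eq_bigr => j ji.
rewrite !(mderivM, mderivXU) eq_sym (negPf ji) !mul0r !add0r mderivM mderivXU.
by rewrite eq_sym (negPf ji) mul0r add0r.
Qed.

(** The commutator of the Laplacian with multiplication by ['X_i] is twice a partial derivative,
    which commutes with the Laplacian. At [j = 0] the coefficient is zero, so [j.-1] is harmless. *)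
Lemma iter_lap_mulX p i (j : nat) : iter j lap ('X_i * p) =
  'X_i * iter j lap p + (2 * j)%:R *: (iter j.-1 lap p)^`M(i).
Proof.
elim: j => [|j IH]; first by rewrite muln0 scale0r addr0.
rewrite !iterS IH linearD linearZ /= lap_mulX lap_mderiv -addrA; congr (_ + _).
case: j {IH} => [|j]; first by rewrite muln0 scale0r addr0.
by rewrite /= -scalerDl -natrD -mulnS.
Qed.

Lemma dhomog_iter_lap (d j : nat) p :
  p \is (d + 2 * j).-homog -> iter j lap p \is d.-homog.
Proof.
elim: j d => [|j IH] d; first by rewrite muln0 addn0.
rewrite mulnS addnA => /IH hp; rewrite iterS /lap.
by apply: rpred_sum => i _; do 2!apply: dhomog_mderiv; rewrite -addn2.
Qed.

Lemma iter_lap_eq0 (d j : nat) p : p \is d.-homog -> (d < 2 * j)%N -> iter j lap p = 0.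
Proof.
elim: j d p => // j IH d p; rewrite iterSr mulnS => hp dj.
have [d2|d2] := leqP 2 d.
  apply: (IH (d - 2)%N); last lia.
  by apply: (@dhomog_iter_lap _ 1); rewrite muln1 subnK.
suff -> : lap p = 0 by rewrite linear0.
rewrite /lap big1 // => i _; case: d hp d2 {dj} => [|[|//]] hp _.
  by rewrite (mderiv_0homog i hp) mderiv0.
by apply/mderiv_0homog/dhomog_mderiv.
Qed.

Lemma meval_dhomog (d : nat) p (c : R) (x : 'I_n -> R) :
  p \is d.-homog -> p.@[fun i => c * x i] = c ^+ d * p.@[x].
Proof.
move: p; apply: dhomog_ind => [|p q hp hq|c0 p hp|m <-].
- by rewrite !meval0 mulr0.
- by rewrite !mevalD hp hq mulrDr.
- by rewrite !mevalZ hp mulrCA.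
- rewrite !mevalX mdegE -prodrXr -big_split; apply: eq_bigr => i _.
  by rewrite exprMn.
Qed.

End HomogeneousPolynomials.

(** * Gaussian integration by parts *)

Section SteinFunctional.
Variables (R : realType) (n K : nat) (E : {scalar {mpoly R[n]}}).
Hypothesis E1 : E 1 = 1.
(** As [msize] exceeds the degree of a nonzero polynomial by one, this is integration by parts up to
    degree [K], a form that a finite quadrature rule can satisfy. *)
Hypothesis stein : forall i (f : {mpoly R[n]}),
  (msize f <= K.+1)%N -> E ('X_i * f) = E f^`M(i).
Implicit Types (p q : {mpoly R[n]}).

Lemma msizeM_leS (a b : nat) p q :
  (msize p <= a.+1)%N -> (msize q <= b.+1)%N -> (msize (p * q) <= (a + b).+1)%N.
Proof.
have [->|p0] := eqVneq p 0; first by rewrite mul0r msize0.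
have [->|q0] := eqVneq q 0; first by rewrite mulr0 msize0.
move=> pa qb; rewrite msizeM // -subn1 leq_subLR.
by apply: leq_trans (leq_add pa qb) _; rewrite addSn addnS add1n.
Qed.

Lemma stein_homog (d : nat) i p : p \is d.-homog -> (d <= K)%N ->
  E ('X_i * p) = E p^`M(i).
Proof. by move=> /dhomog_msize_le hp dK; apply: stein; apply: leq_trans hp _. Qed.

Lemma dhomogXi i : ('X_i : {mpoly R[n]}) \is 1.-homog.
Proof. by rewrite dhomogX /= mdeg1. Qed.

Lemma dhomog_sqnorm : sqnorm_mpoly R n \is 2.-homog.
Proof. by apply: rpred_sum => i _; exact: (dhomogMn 2 (dhomogXi i)). Qed.

(** Integrating by parts in each coordinate gives [n] copies of [E p] and the Euler sum, which
    contributes [d] more. *)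
Lemma stein_sqnorm (d : nat) p : p \is d.-homog -> (d.+1 <= K)%N ->
  E (sqnorm_mpoly R n * p) = (n + d)%:R * E p.
Proof.
move=> hp dK; rewrite /sqnorm_mpoly mulr_suml linear_sum /=.
have -> : \sum_i E ('X_i ^+ 2 * p) = \sum_i (E p + E ('X_i * p^`M(i))).
  apply: eq_bigr => i _; rewrite expr2 -mulrA (@stein_homog d.+1) //; last first.
    by apply: (dhomogM (dhomogXi i)).
  by rewrite mderivM mderivXU eqxx mul1r linearD.
have euler : \sum_i E ('X_i * p^`M(i)) = d%:R * E p.
  by rewrite -linear_sum (euler_identity hp) linearZ.
rewrite big_split /= euler sumr_const card_ord.
by rewrite natrD mulrDl (mulr_natl _ n).
Qed.

Definition rising2 (a j : nat) : R := \prod_(l < j) (a + 2 * l)%:R.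

Lemma stein_sqnormX (d j : nat) p : p \is d.-homog -> (d + 2 * j <= K)%N ->
  E (sqnorm_mpoly R n ^+ j * p) = rising2 (n + d) j * E p.
Proof.
move=> hp; elim: j => [|j IH] dK.
  by rewrite expr0 mul1r /rising2 big_ord0 mul1r.
rewrite exprS -mulrA (@stein_sqnorm (2 * j + d)); first last.
- lia.
- by apply: dhomogM => //; exact: dhomogMn dhomog_sqnorm.
rewrite IH ?mulrA; last lia.
by congr (_ * _); rewrite /rising2 big_ord_recr /= mulrC [(2 * j + d)%N]addnC addnA.
Qed.

Variable x : 'I_n -> R.
Definition linform : {mpoly R[n]} := \sum_i x i *: 'X_i.

Lemma dhomog_linform : linform \is 1.-homog.
Proof. by apply: rpred_sum => i _; apply/rpredZ/dhomogXi. Qed.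

Lemma mderiv_linform i : linform^`M(i) = (x i)%:MP.
Proof.
rewrite /linform raddf_sum (bigD1 i) //= mderivZ mderivXU eqxx.
rewrite big1 ?addr0 => [|j /negPf ji]; last by rewrite mderivZ mderivXU ji scaler0.
by rewrite -mul_mpolyC mulr1.
Qed.

Lemma mderiv_linformX i (s : nat) :
  (linform ^+ s)^`M(i) = (s%:R * x i) *: linform ^+ s.-1.
Proof.
case: s => [|s]; first by rewrite expr0 mderivC mul0r scale0r.
by rewrite mderivXn mderiv_linform mul_mpolyC scalerA.
Qed.

Definition sqnormv : R := \sum_i x i ^+ 2.

Lemma stein_linformX (s : nat) : (s.+1 <= K)%N ->
  E (linform ^+ s.+2) = s.+1%:R * sqnormv * E (linform ^+ s).
Proof.
move=> sK; rewrite exprS {1}/linform mulr_suml linear_sum /=.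
rewrite /sqnormv mulr_sumr mulr_suml; apply: eq_bigr => i _.
rewrite -scalerAl linearZ /= (@stein_homog s.+1) //.
  by rewrite mderiv_linformX linearZ /= expr2; ring.
by rewrite -[X in X.-homog]mul1n; exact: dhomogMn dhomog_linform.
Qed.

(** The double factorial of [2 M - 1], the moment of order [2 M] of a standard Gaussian variable. *)
Definition odd_fact (M : nat) : R := \prod_(l < M) (2 * l).+1%:R.

(** Up to the allowed degree, [linform] behaves under [E] as a centred Gaussian variable of variance
    [sqnormv]. *)
Lemma hilbert_identity (M : nat) : (2 * M <= K.+1)%N ->
  E (linform ^+ (2 * M)) = odd_fact M * sqnormv ^+ M.
Proof.
elim: M => [|M IH] MK; first by rewrite muln0 expr0 E1 /odd_fact big_ord0 mul1r.
rewrite mulnS stein_linformX; last lia.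
rewrite IH; last lia.
rewrite /odd_fact big_ord_recr /= exprS; ring.
Qed.

Definition hermite_coef (j : nat) : R := (-1) ^+ j / (2 ^+ j * j`!%:R).

(* A truncation of [exp (- lap / 2) p]. *)
Definition hermite_part (B : nat) p : {mpoly R[n]} :=
  \sum_(j < B) hermite_coef j *: iter j (@lap R n) p.

Lemma hermite_part_is_linear (B : nat) : linear (hermite_part B).
Proof.
move=> c p q; rewrite /hermite_part scaler_sumr -big_split.
apply: eq_bigr => j _ /=.
by rewrite linearP scalerDr !scalerA [c * _]mulrC.
Qed.
HB.instance Definition _ (B : nat) :=
  GRing.isLinear.Build R {mpoly R[n]} {mpoly R[n]} _ (hermite_part B)
  (hermite_part_is_linear B).

(** The Hermite recursion. The commutator term of order [j + 1] becomes minus the derivative of the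
    term of order [j], which is why the truncation drops from [B.+1] to [B]. *)
Lemma hermite_part_mulX (B : nat) p i : hermite_part B.+1 ('X_i * p) =
  'X_i * hermite_part B.+1 p - (hermite_part B p)^`M(i).
Proof.
rewrite /hermite_part; under eq_bigr do rewrite iter_lap_mulX scalerDr scalerAr.
rewrite big_split /= -mulr_sumr; congr (_ + _).
rewrite big_ord_recl muln0 scale0r scaler0 add0r (raddf_sum (@mderiv n R i)) -sumrN.
apply: eq_bigr => j _ /=; rewrite mderivZ scalerA -scaleNr; congr (_ *: _).
rewrite /hermite_coef !exprS factS !natrM /bump /= add1n.
field.
by rewrite pnatr_eq0 -lt0n fact_gt0 expf_neq0 ?pnatr_eq0 // addrC natr1 pnatr_eq0.
Qed.

Lemma hermite_part_msize (B d : nat) p : p \is d.-homog ->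
  (msize (hermite_part B p) <= d.+1)%N.
Proof.
move=> hp; rewrite /hermite_part; elim/big_ind: _ => [|f g hf hg|j _].
- by rewrite msize0.
- by apply: leq_trans (msizeD_le f g) _; rewrite geq_max hf.
apply: leq_trans (msizeZ_le _ _) _; have [dj|jd] := ltnP d (2 * j).
  by rewrite (iter_lap_eq0 hp dj) msize0.
apply: leq_trans (@dhomog_msize_le R n (d - 2 * j)%N _ _) _; last by rewrite ltnS leq_subr.
by apply: dhomog_iter_lap; rewrite subnK.
Qed.

Lemma hermite_part_id (B k : nat) p : p \is k.-homog -> (k < B)%N ->
  hermite_part B.+1 p = hermite_part B p.
Proof.
move=> hp kB; rewrite /hermite_part big_ord_recr /= (iter_lap_eq0 hp); last lia.
by rewrite scaler0 addr0.
Qed.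

(** Multiplication by ['X_i] minus differentiation is adjoint to differentiation. Hence each
    variable of a monomial [p] moves onto the power of [linform] as a derivative, releasing a factor
    [x i] and a factor of [s ^_ k]. *)
Lemma stein_hermite (B k s : nat) p : p \is k.-homog -> (k < B)%N ->
  (k <= s)%N -> (k + s <= K.+1)%N ->
  E (hermite_part B p * linform ^+ s) =
    (s ^_ k)%:R * p.@[x] * E (linform ^+ (s - k)).
Proof.
elim: k B s p => [|k IH] B s p.
  move=> hp kB _ sK; rewrite ffactn0 subn0 mul1r.
  have -> : hermite_part B p = p.
    case: B kB => // B _; rewrite /hermite_part big_ord_recl big1 => [|j _].
      by rewrite /hermite_coef !expr0 fact0 mulr1 divr1 scale1r addr0.
    by rewrite (iter_lap_eq0 hp) ?scaler0 //= /bump.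
  have := dhomog_msize_le hp => /msize1_polyC ->.
  by rewrite mul_mpolyC linearZ mevalC.
case: s => // s hp; case: B => // B kB ks ksK; rewrite !ltnS in kB ks.
move: p hp; apply: dhomog_ind => [|p q hp hq|c p hp|m mk].
- by rewrite linear0 mul0r linear0 meval0 mulr0 mul0r.
- by rewrite linearD /= mulrDl linearD /= hp hq mevalD mulrDr mulrDl.
- by rewrite linearZ /= -scalerAl linearZ /= hp mevalZ; ring.
have [i mi] : exists i, m i != 0%N.
  apply/existsP; rewrite -negb_forall; apply: contraPN mk => /forallP m0.
  by rewrite mdegE big1 // => i _; apply/eqP.
have -> : 'X_[m] = 'X_i * 'X_[m - U_(i)] :> {mpoly R[n]}.
  by rewrite -mpolyXD addmC submK // lep1mP.
set p := 'X_[m - U_(i)].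
have hp : p \is k.-homog.
  rewrite dhomogX /= -eqSS -mk -addn1 -(mdeg1 i) -mdegD submK ?lep1mP //.
(* Since [k < B], both truncations for [p] agree, and the two terms with a derivative of the Hermite
   polynomial cancel after integration by parts. *)
rewrite hermite_part_mulX (hermite_part_id hp kB) mulrBl linearB /= -['X_i * _ * _]mulrA.
rewrite stein; last first.
  have ls : (msize (linform ^+ s.+1) <= s.+2)%N.
    by apply: dhomog_msize_le; rewrite -[X in X.-homog]mul1n; exact: dhomogMn dhomog_linform.
  by apply: leq_trans (msizeM_leS (hermite_part_msize B hp) ls) _; lia.
rewrite mderivM linearD /= addrC addKr mderiv_linformX -scalerAr linearZ /=.
rewrite IH //; last lia.
rewrite mevalM mevalXU ffactSS natrM subSS; ring.
Qed.
End SteinFunctional.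

(** * Homogenized Hermite polynomials and their Gaussian means *)

Section HomogenizedHermite.
Variables (R : realType) (n d N : nat).
Implicit Types (p : {mpoly R[n]}).

(* The factor [rising2] is the one by which multiplication with [sqnorm ^ j]
   rescales the average of [stein_sqnormX]. *)
Definition homog_coef (j : nat) : R :=
  hermite_coef R j / rising2 R (n + (2 * d - 2 * j + 2 * N)) j.

Definition homog_hermite p : {mpoly R[n]} :=
  \sum_(j < (2 * d).+1)
    homog_coef j *: (sqnorm_mpoly R n ^+ j * iter j (@lap R n) p).

Lemma homog_hermite_is_linear : linear homog_hermite.
Proof.
move=> c p q; rewrite /homog_hermite scaler_sumr -big_split.
apply: eq_bigr => j _ /=.
by rewrite linearP mulrDr scalerDr -scalerAr !scalerA [c * _]mulrC.
Qed.
HB.instance Definition _ :=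
  GRing.isLinear.Build R {mpoly R[n]} {mpoly R[n]} _ homog_hermite
  homog_hermite_is_linear.

Lemma rising2_ge (a j : nat) : (0 < a)%N -> a%:R <= rising2 R a j.+1.
Proof.
move=> a0; rewrite /rising2 big_ord_recl muln0 addn0 ler_peMr ?ler0n //.
elim/big_ind: _ => [//|u v|i _]; first exact: mulr_ege1.
by rewrite ler1n addn_gt0 a0.
Qed.

Lemma rising2_gt0 (a j : nat) : (0 < a)%N -> 0 < rising2 R a j.
Proof.
case: j => [|j] a0; first by rewrite /rising2 big_ord0.
by apply: lt_le_trans (rising2_ge j a0); rewrite ltr0n.
Qed.

Lemma dhomog_homog_hermite p : p \is (2 * d).-homog ->
  homog_hermite p \is (2 * d).-homog.
Proof.
move=> hp; apply: rpred_sum => j _; apply: rpredZ.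
have [dj|jd] := ltnP (2 * d) (2 * j).
  by rewrite (iter_lap_eq0 hp dj) mulr0 rpred0.
move: (nat_of_ord j) jd => k kd; rewrite -(subnKC kd).
apply: dhomogM; first exact: dhomogMn (dhomog_sqnorm R n).
by apply: dhomog_iter_lap; rewrite subnK.
Qed.

Lemma stein_homog_hermite (K : nat) (E : {scalar {mpoly R[n]}}) p
    (x : 'I_n -> R) :
  E 1 = 1 ->
  (forall i (f : {mpoly R[n]}), (msize f <= K.+1)%N -> E ('X_i * f) = E f^`M(i)) ->
  p \is (2 * d).-homog -> (0 < N)%N -> (d <= N)%N -> (2 * d + 2 * N <= K)%N ->
  E (homog_hermite p * linform x ^+ (2 * N)) =
    ((2 * N) ^_ (2 * d))%:R * odd_fact R (N - d) * (p.@[x] * sqnormv x ^+ (N - d)).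
Proof.
move=> E1 stein hp N0 dN dNK.
have -> : E (homog_hermite p * linform x ^+ (2 * N)) =
    E (hermite_part (2 * d).+1 p * linform x ^+ (2 * N)).
  rewrite /homog_hermite /hermite_part !mulr_suml !linear_sum; apply: eq_bigr => j _.
  rewrite -!scalerAl !linearZ -[_ * _ * linform x ^+ _]mulrA /=.
  (* At these orders the iterated Laplacian is zero, so the truncated subtraction in [homog_coef]
     does no harm. *)
  have [dj|jd] := ltnP (2 * d) (2 * j).
    by rewrite (iter_lap_eq0 hp dj) !(mul0r, mulr0) linear0 !mulr0.
  rewrite (@stein_sqnormX R n K E stein (2 * d - 2 * j + 2 * N)); first last.
  - lia.
  - apply: dhomogM; first by apply: dhomog_iter_lap; rewrite subnK.
    by rewrite -[X in X.-homog]mul1n; exact: dhomogMn (dhomog_linform x).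
  rewrite mulrA divfK // gt_eqF // rising2_gt0 //; lia.
rewrite (@stein_hermite R n K E stein x (2 * d).+1 (2 * d)) //; [|lia|lia].
rewrite -mulnBr (@hilbert_identity R n K E E1 stein); last lia.
ring.
Qed.

End HomogenizedHermite.

(** * The product of one-dimensional quadratures on a grid *)

Section GridExpectation.
Variables (R : realType) (n M : nat) (w t : 'I_M -> R).
Implicit Types (f : {mpoly R[n]}).

Definition grid_weight (g : {ffun 'I_n -> 'I_M}) : R := \prod_i w (g i).
Definition grid_point (g : {ffun 'I_n -> 'I_M}) : 'I_n -> R := fun i => t (g i).
Definition grid_mean f : R :=
  \sum_(g : {ffun 'I_n -> 'I_M}) grid_weight g * f.@[grid_point g].

Lemma grid_mean_is_scalar : scalar grid_mean.
Proof.
move=> c f h; rewrite /grid_mean mulr_sumr -big_split; apply: eq_bigr => g _ /=.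
by rewrite mevalD mevalZ mulrDr mulrCA.
Qed.
HB.instance Definition _ := GRing.isLinear.Build R {mpoly R[n]} R _ grid_mean
  grid_mean_is_scalar.

Lemma grid_meanX (m : 'X_{1..n}) :
  grid_mean 'X_[m] = \prod_i \sum_j w j * t j ^+ m i.
Proof.
rewrite bigA_distr_bigA /grid_mean; apply: eq_bigr => g _.
by rewrite mevalX -big_split.
Qed.

Lemma grid_mean1 : \sum_j w j = 1 -> grid_mean 1 = 1.
Proof.
move=> w1; rewrite -mpolyX0 grid_meanX big1 // => i _; rewrite -[RHS]w1.
by apply: eq_bigr => j _; rewrite mnm0E expr0 mulr1.
Qed.

(** On monomials the mean factors over the coordinates; only the factor of coordinate [i] changes,
    and there the one-dimensional moment recursion applies. *)
Lemma grid_stein (K : nat) :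
  (forall k, (k <= K)%N ->
      \sum_j w j * t j ^+ k.+1 = k%:R * \sum_j w j * t j ^+ k.-1) ->
  forall i f, (msize f <= K.+1)%N -> grid_mean ('X_i * f) = grid_mean f^`M(i).
Proof.
move=> moments i f fK; rewrite {1}(mpolyE f) mulr_sumr [LHS]raddf_sum.
rewrite [in RHS](mpolyE f).
rewrite (raddf_sum (@mderiv n R i)) [RHS]raddf_sum; apply: eq_big_seq => m mf /=.
rewrite -scalerAr mderivZ !linearZ /= mderivX linearZ /= -mpolyXD; congr (_ * _).
rewrite !grid_meanX (bigD1 i) // [in RHS](bigD1 i) //= mulrA; congr (_ * _).
  rewrite mnmDE mnm1E eqxx add1n mnmBE mnm1E eqxx subn1; apply: moments.
  rewrite -ltnS; apply: leq_trans fK; apply: leq_ltn_trans (msize_mdeg_lt mf).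
  by rewrite mdegE (bigD1 i) //= leq_addr.
apply: eq_bigr => l li; apply: eq_bigr => j _.
by rewrite mnmDE mnmBE mnm1E eq_sym (negPf li) add0n subn0.
Qed.

End GridExpectation.

Lemma reznick_average (R : realType) (n d N : nat) :
  (0 < N)%N -> (d <= N)%N ->
  exists (G : finType) (w : G -> R) (a : G -> 'I_n -> R),
  [/\ forall g, 0 <= w g &
    forall (p : {mpoly R[n]}) (x : 'I_n -> R), p \is (2 * d).-homog ->
      \sum_g w g * ((homog_hermite d N p).@[a g] * (\sum_i x i * a g i) ^+ (2 * N)) =
      p.@[x] * (\sum_i x i ^+ 2) ^+ (N - d)].
Proof.
move=> N0 dN.
(* The order of the rule is the total degree of the averaged product; the positive constant [c] is
   then absorbed into the weights. *)
have [w [t [w0 w1 moments]]] := Quadrature.gauss_hermite_quadrature R (2 * d + 2 * N).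
pose c : R := ((2 * N) ^_ (2 * d))%:R * odd_fact R (N - d).
have c0 : 0 < c.
  rewrite mulr_gt0 ?ltr0n ?ffact_gt0 ?leq_pmul2l //.
  by rewrite /odd_fact prodr_gt0 // => i _; rewrite ltr0n.
exists {ffun 'I_n -> 'I_(2 * d + 2 * N).+1}.
exists (fun g => c^-1 * grid_weight w g), (grid_point t); split=> [g|p x hp].
  by rewrite mulr_ge0 ?invr_ge0 ?(ltW c0) // prodr_ge0.
have := stein_homog_hermite x (@grid_mean1 R n _ w t w1) (@grid_stein R n _ w t _ moments)
  hp N0 dN (leqnn _).
rewrite -/c => mean; clearbody c; apply: (mulfI (lt0r_neq0 c0)); rewrite -mean.
rewrite /grid_mean mulr_sumr; apply: eq_bigr => g _.
have lE : (linform x).@[grid_point t g] = \sum_i x i * grid_point t g i.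
  rewrite /linform raddf_sum; apply: eq_bigr => i _ /=.
  by rewrite mevalZ mevalXU.
by rewrite -!mulrA mulVKf ?gt_eqF // mevalM rmorphXn /= lE.
Qed.

(** * Positivity of the averaged matrix *)

Import Compactness.

Section PolynomialFunctions.
Variables (R : realType) (k : nat).
Implicit Types (f : 'rV[R]_k -> R).

Lemma polyfun_sum (I : Type) (r : seq I) (F : I -> 'rV[R]_k -> R) :
  (forall i, polyfun (F i)) -> polyfun (fun z => \sum_(i <- r) F i z).
Proof.
move=> hF; elim: r => [|i r IH].
  by under boolp.eq_fun do rewrite big_nil; exact: polyfun_cst.
by under boolp.eq_fun do rewrite big_cons; exact: polyfun_add.
Qed.

Lemma polyfun_prod (I : Type) (r : seq I) (F : I -> 'rV[R]_k -> R) :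
  (forall i, polyfun (F i)) -> polyfun (fun z => \prod_(i <- r) F i z).
Proof.
move=> hF; elim: r => [|i r IH].
  by under boolp.eq_fun do rewrite big_nil; exact: polyfun_cst.
by under boolp.eq_fun do rewrite big_cons; exact: polyfun_mul.
Qed.

Lemma polyfun_exp (e : nat) f : polyfun f -> polyfun (fun z => f z ^+ e).
Proof.
move=> hf; elim: e => [|e IH].
  by under boolp.eq_fun do rewrite expr0; exact: polyfun_cst.
by under boolp.eq_fun do rewrite exprS; exact: polyfun_mul.
Qed.

Lemma polyfun_meval (n : nat) (p : {mpoly R[n]}) (h : 'I_n -> 'I_k) :
  polyfun (fun z => p.@[fun i => z ord0 (h i)]).
Proof.
under boolp.eq_fun do rewrite mevalE.
apply: polyfun_sum => m; apply: polyfun_mul; first exact: polyfun_cst.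
by apply: polyfun_prod => i; apply: polyfun_exp; exact: polyfun_coord.
Qed.

Lemma polyfun_bounded f : polyfun f ->
  exists B, forall z : 'rV[R]_k, (forall i, `|z ord0 i| <= 1) -> `|f z| <= B.
Proof.
elim=> [c|i|g h _ [B gB] _ [C hC]|g h _ [B gB] _ [C hC]].
- by exists `|c|.
- by exists 1.
- exists (B + C) => z zb; apply: le_trans (ler_normD _ _) _.
  by rewrite lerD ?gB ?hC.
- by exists (B * C) => z zb; rewrite normrM ler_pM ?gB ?hC.
Qed.

End PolynomialFunctions.

Lemma polar_decomposition (R : realType) (n : nat) (a : 'I_n.+1 -> R) :
  exists (s : R) (u : 'I_n.+1 -> R),
    [/\ 0 <= s, \sum_i u i ^+ 2 = 1 & forall i, a i = s * u i].
Proof.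
have S0 : 0 <= \sum_i a i ^+ 2 by apply: sumr_ge0 => i _; exact: sqr_ge0.
have [S|S] := eqVneq (\sum_i a i ^+ 2) 0.
  exists 0, (fun i => (i == ord0)%:R); split=> // [|i].
    rewrite (bigD1 ord0) //= expr1n big1 ?addr0 // => i /negPf ->.
    by rewrite expr0n.
  have /psumr_eq0P /(_ S) /(_ i isT) /eqP : forall i : 'I_n.+1, true -> 0 <= a i ^+ 2.
    by move=> j _; exact: sqr_ge0.
  by rewrite sqrf_eq0 => /eqP ->; rewrite mul0r.
exists (Num.sqrt (\sum_i a i ^+ 2)), (fun i => a i / Num.sqrt (\sum_i a i ^+ 2)).
have s0 : Num.sqrt (\sum_i a i ^+ 2) != 0 by rewrite sqrtr_eq0 -ltNge lt_def S.
split=> [||i]; first exact: sqrtr_ge0; last by rewrite mulrC divfK.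
under eq_bigr do rewrite exprMn exprVn sqr_sqrtr //.
by rewrite -mulr_suml mulfV.
Qed.

Lemma unit_coord_le1 (R : realType) (n : nat) (u : 'I_n -> R) i :
  \sum_i u i ^+ 2 = 1 -> `|u i| <= 1.
Proof.
move=> u1; rewrite -(@ler_pXn2r _ 2) ?nnegrE // expr1n real_normK ?num_real // -u1.
by rewrite (bigD1 i) //= lerDl; apply: sumr_ge0 => j _; exact: sqr_ge0.
Qed.

Definition mpoly_form (R : realType) (n m : nat) (Q : 'M[{mpoly R[n]}]_m)
    (x : 'I_n -> R) (v : 'I_m -> R) : R :=
  \sum_i \sum_j v i * v j * (Q i j).@[x].

Lemma mpoly_formE (R : realType) (n m : nat) (Q : 'M[{mpoly R[n]}]_m)
    (x : 'I_n -> R) (v : 'cV[R]_m) :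
  (v^T *m map_mx (meval x) Q *m v) ord0 ord0 = mpoly_form Q x (fun i => v i ord0).
Proof.
rewrite mxE /mpoly_form exchange_big; apply: eq_bigr => j _ /=.
rewrite mxE mulr_suml; apply: eq_bigr => i _; rewrite !mxE; ring.
Qed.

Lemma mpoly_form_scale (R : realType) (n m d : nat) (Q : 'M[{mpoly R[n]}]_m)
    (x : 'I_n -> R) (v : 'I_m -> R) (s t : R) :
  (forall i j, Q i j \is d.-homog) ->
  mpoly_form Q (fun i => s * x i) (fun i => t * v i) =
    s ^+ d * t ^+ 2 * mpoly_form Q x v.
Proof.
move=> hQ; rewrite /mpoly_form mulr_sumr; apply: eq_bigr => i _.
rewrite mulr_sumr; apply: eq_bigr => j _.
rewrite (meval_dhomog _ _ (hQ i j)); ring.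
Qed.

Lemma eq_mpoly_form (R : realType) (n m : nat) (Q : 'M[{mpoly R[n]}]_m)
    (x y : 'I_n -> R) (v w : 'I_m -> R) :
  x =1 y -> v =1 w -> mpoly_form Q x v = mpoly_form Q y w.
Proof.
move=> xy vw; apply: eq_bigr => i _; apply: eq_bigr => j _.
by rewrite !vw (meval_eq _ xy).
Qed.

Lemma homog_coef0 (R : realType) (n d N : nat) : homog_coef R n d N 0 = 1.
Proof.
by rewrite /homog_coef /hermite_coef /rising2 big_ord0 !expr0 fact0 !mulr1 !divr1.
Qed.

(** The Hermite coefficient is at most one in absolute value, and the first factor of [rising2] is
    at least [N]. *)
Lemma homog_coef_small (R : realType) (n d N j : nat) : (0 < N)%N ->
  `|homog_coef R n d N j.+1| <= N%:R^-1.
Proof.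
move=> N0; have a0 : (0 < n + (2 * d - 2 * j.+1 + 2 * N))%N by lia.
have r0 := rising2_gt0 R j.+1 a0.
rewrite /homog_coef normrM normfV (gtr0_norm r0).
apply: (@le_trans _ _ (1 * (rising2 R (n + (2 * d - 2 * j.+1 + 2 * N)) j.+1)^-1)).
  apply: ler_wpM2r; first by rewrite invr_ge0 ltW.
  rewrite /hermite_coef normrM normrX normrN1 expr1n mul1r normfV.
  rewrite invf_le1 ?normr_gt0 ?mulf_neq0 ?expf_neq0 ?pnatr_eq0 -?lt0n ?fact_gt0 //.
  by rewrite -natrX -natrM ger0_norm ?ler0n // ler1n muln_gt0 expn_gt0 fact_gt0.
rewrite mul1r lef_pV2 ?posrE ?ltr0n //; apply: le_trans (rising2_ge R j a0).
by rewrite ler_nat; lia.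
Qed.

Lemma mpoly_form_homog_hermite (R : realType) (n m d N : nat)
    (P : 'M[{mpoly R[n]}]_m) (x : 'I_n -> R) (v : 'I_m -> R) :
  mpoly_form (map_mx (homog_hermite d N) P) x v =
  \sum_(l < (2 * d).+1) homog_coef R n d N l *
    mpoly_form (map_mx (fun p => sqnorm_mpoly R n ^+ l * iter l (@lap R n) p) P) x v.
Proof.
rewrite /mpoly_form; under [RHS]eq_bigr do rewrite mulr_sumr.
rewrite [RHS]exchange_big; apply: eq_bigr => i _.
under [RHS]eq_bigr do rewrite mulr_sumr.
rewrite [RHS]exchange_big; apply: eq_bigr => j _.
rewrite mxE {1}/homog_hermite raddf_sum mulr_sumr; apply: eq_bigr => l _ /=.
by rewrite !mxE mevalZ mulrCA.
Qed.

(** On a product of unit spheres the form of [P] is at least some [delta > 0], while the corrections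
    are of order [1 / N]; homogeneity in the point and in the vector carries the sign to all
    arguments. *)
Lemma homog_hermite_psd (R : realType) (n m d : nat)
    (P : 'M[{mpoly R[n.+1]}]_m.+1) :
  (forall i j, P i j \is (2 * d).-homog) ->
  (forall x : 'rV[R]_n.+1, x != 0 -> posdef (eval_mx P x)) ->
  exists N, [/\ (0 < N)%N, (d <= N)%N & forall a : 'I_n.+1 -> R,
    psd (map_mx (meval a) (map_mx (homog_hermite d N) P))].
Proof.
move=> hP Ppos.
pose X (z : 'rV[R]_(n.+1 + m.+1)) i := z ord0 (lshift m.+1 i).
pose V (z : 'rV[R]_(n.+1 + m.+1)) i := z ord0 (rshift n.+1 i).
have polyform Q : polyfun (fun z => mpoly_form Q (X z) (V z)).
  apply: polyfun_sum => i; apply: polyfun_sum => j.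
  apply: polyfun_mul; last exact: polyfun_meval.
  by apply: polyfun_mul; exact: polyfun_coord.
have polysum k (h : 'I_k -> 'I_(n.+1 + m.+1)) :
    polyfun (fun z : 'rV[R]_(n.+1 + m.+1) => \sum_i z ord0 (h i) ^+ 2).
  by apply: polyfun_sum => i; apply: polyfun_exp; exact: polyfun_coord.
have [|delta d0 dP] := box_level_min (polyform P) (polysum _ (lshift m.+1))
    (polysum _ (@rshift n.+1 m.+1)).
  move=> z _ x1 v1.
  have x0 : \row_i X z i != 0.
    apply: contra_eq_neq x1 => /rowP x0; rewrite big1 1?eq_sym ?oner_eq0 // => i _.
    by have := x0 i; rewrite !mxE /X => ->; rewrite expr0n.
  have [_ /(_ (\col_i V z i))] := Ppos _ x0.
  rewrite mpoly_formE (eq_mpoly_form P (y := X z) (w := V z)).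
  - apply; apply: contra_eq_neq v1 => /colP v0.
    rewrite big1 1?eq_sym ?oner_eq0 // => i _.
    by have := v0 i; rewrite !mxE /V => ->; rewrite expr0n.
  - by move=> i; rewrite mxE.
  - by move=> i; rewrite mxE.
pose F l := fun z => mpoly_form
  (map_mx (fun p => sqnorm_mpoly R n.+1 ^+ l * iter l (@lap R n.+1) p) P) (X z) (V z).
(* The summand [F ^ 2 + 1] dominates the absolute value of [F] and is still a polynomial
   function. *)
have [|B SB] := @polyfun_bounded R _ (fun z => \sum_(l < 2 * d) (F l.+1 z ^+ 2 + 1)).
  apply: polyfun_sum => l; apply: polyfun_add; last exact: polyfun_cst.
  by apply: polyfun_exp; exact: polyform.
have [N NB] : exists N, B / delta < N%:R.
  exists (Num.bound `|B / delta|).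
  exact: le_lt_trans (ler_norm _) (archi_boundP (normr_ge0 _)).
(* This is positive, at least [d], and large enough for [B / M <= delta]. *)
pose M := (N + d).+1.
exists M; split=> [//||a v]; first by rewrite /M; lia.
have [s [u [s0 u1 aE]]] := polar_decomposition a.
have [r [w [r0 w1 vE]]] := polar_decomposition (fun i => v i ord0).
rewrite mpoly_formE (eq_mpoly_form _ aE vE) (@mpoly_form_scale _ _ _ (2 * d)); last first.
  by move=> i j; rewrite mxE; exact: dhomog_homog_hermite.
apply: mulr_ge0; first by rewrite mulr_ge0 ?exprn_ge0 ?sqr_ge0.
pose z : 'rV[R]_(n.+1 + m.+1) := row_mx (\row_i u i) (\row_i w i).
have Xz : u =1 X z by move=> i; rewrite /X /z row_mxEl mxE.
have Vz : w =1 V z by move=> i; rewrite /V /z row_mxEr mxE.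
rewrite (eq_mpoly_form _ Xz Vz) mpoly_form_homog_hermite big_ord_recl.
have zb i : `|z ord0 i| <= 1.
  rewrite /z mxE; case: split => j; rewrite mxE; exact: unit_coord_le1.
have gz : \sum_i z ord0 (lshift m.+1 i) ^+ 2 = 1.
  by rewrite -u1; apply: eq_bigr => i _; rewrite -/(X z i) -Xz.
have hz : \sum_i z ord0 (rshift n.+1 i) ^+ 2 = 1.
  by rewrite -w1; apply: eq_bigr => i _; rewrite -/(V z i) -Vz.
have -> : map_mx (fun p => sqnorm_mpoly R n.+1 ^+ 0 * iter 0 (@lap R n.+1) p) P = P.
  by apply/matrixP => i j; rewrite mxE mul1r.
rewrite homog_coef0 mul1r.
have le_sum : `|\sum_(l < 2 * d) homog_coef R n.+1 d M l.+1 * F l.+1 z| <= B / M%:R.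
  apply: le_trans (ler_norm_sum _ _ _) _.
  apply: (@le_trans _ _ ((\sum_(l < 2 * d) (F l.+1 z ^+ 2 + 1)) / M%:R)); last first.
    by apply: ler_wpM2r; rewrite ?invr_ge0 ?ler0n //; apply: le_trans (ler_norm _) (SB z zb).
  rewrite mulr_suml; apply: ler_sum => l _; rewrite normrM mulrC.
  apply: ler_pM => //; last exact: homog_coef_small.
  rewrite -[F _ _ ^+ 2]real_normK ?num_real //.
  by have := sqr_ge0 (`|F l.+1 z| - 1); have := normr_ge0 (F l.+1 z); nra.
have M0 : 0 < M%:R :> R by rewrite ltr0n.
have small : B / M%:R <= delta.
  rewrite ler_pdivrMr //; move: NB; rewrite ltr_pdivrMr // => NB.
  apply: le_trans (ltW NB) _; rewrite mulrC ler_wpM2l ?(ltW d0) // ler_nat /M; lia.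
have := dP z zb gz hz.
move: le_sum; rewrite ler_norml => /andP[le_sum _] dz.
rewrite -[leLHS](subrr delta); apply: lerD => //.
by apply: le_trans le_sum; rewrite lerN2.
Qed.

(** * Clique decomposition *)

Section HomogeneousIdentity.
Variables (R : realType) (n : nat).
Implicit Types (p : {mpoly R[n]}) (x : 'I_n -> R).

(** The restriction of [p] to the line through [x] parallel to axis [i]. *)
Definition line_poly x i p : {poly R} :=
  mmap (@polyC R) (fun j => (x j)%:P + (j == i)%:R * 'X) p.

Lemma horner_line_poly x i p c :
  (line_poly x i p).[c] = p.@[fun j => x j + (j == i)%:R * c].
Proof.
rewrite /line_poly /meval /mmap horner_sum; apply: eq_bigr => m _.
rewrite hornerM hornerC /mmap1 horner_prod; congr (_ * _); apply: eq_bigr => j _.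
by rewrite horner_exp hornerD hornerC hornerM hornerX -polyC_natr hornerC.
Qed.

Lemma deriv_line_poly x i p : (line_poly x i p)^`() = line_poly x i p^`M(i).
Proof.
elim/mpolyind: p => [|c m p _ _ IH]; first by rewrite mderiv0 /line_poly mmap0 deriv0.
rewrite mderivD mderivZ mderivX /line_poly !mmapD derivD IH; congr (_ + _).
rewrite !mmapZ !mmapX derivM derivC mul0r add0r; congr (_ * _).
rewrite /mmap1 (bigD1 i) //= [in RHS](bigD1 i) //= eqxx mul1r.
have [r rE] : exists r : R, forall m' : 'X_{1..n}, (forall j, j != i -> m' j = m j) ->
    \prod_(j < n | j != i) ((x j)%:P + (j == i)%:R * 'X) ^+ m' j = r%:P.
  exists (\prod_(j < n | j != i) x j ^+ m j) => m' m'm; rewrite rmorph_prod.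
  by apply: eq_bigr => j ji; rewrite (negPf ji) mul0r addr0 rmorphXn m'm.
rewrite !rE // => [|j ji]; last by rewrite mnmBE mnm1E eq_sym (negPf ji) subn0.
rewrite derivM derivC mulr0 addr0 deriv_exp derivD derivC derivX add0r mul1r.
by rewrite mnmBE mnm1E eqxx subn1 polyC_natr mulrnAl mulr_natl.
Qed.

(** Each restriction to a line has as many distinct natural numbers as roots as its size, so it is
    the zero polynomial and so is its derivative. *)
Lemma mderiv_meval_eq0 p i : (forall x, p.@[x] = 0) -> forall x, p^`M(i).@[x] = 0.
Proof.
move=> p0 x.
have lp0 : line_poly x i p = 0.
  apply: (@roots_geq_poly_eq0 _ _ [seq k%:R | k <- iota 0 (size (line_poly x i p))]).
  - by apply/allP => c _; rewrite /root horner_line_poly p0.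
  - rewrite map_inj_uniq ?iota_uniq // => a b /eqP; rewrite eqr_nat => /eqP ->//.
  - by rewrite size_map size_iota.
have := horner_line_poly x i p^`M(i) 0.
rewrite -deriv_line_poly lp0 deriv0 horner0 => ->.
by apply: meval_eq => j; rewrite mulr0 addr0.
Qed.

(** Induction on the degree: the partial derivatives vanish as functions, hence as polynomials, and
    the Euler identity recovers [p] from them. *)
Lemma dhomog_meval_eq0 (d : nat) p :
  p \is d.-homog -> (forall x, p.@[x] = 0) -> p = 0.
Proof.
elim: d p => [|d IH] p hp p0.
  move: (p0 (fun=> 0)); have := dhomog_msize_le hp => /msize1_polyC ->.
  by rewrite mevalC => ->.
have : d.+1%:R *: p = 0.
  rewrite -(euler_identity hp) big1 // => i _.
  rewrite (IH p^`M(i)) ?mulr0 //; first exact: dhomog_mderiv.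
  exact: mderiv_meval_eq0.
by move/eqP; rewrite scaler_eq0 pnatr_eq0 => /eqP.
Qed.

End HomogeneousIdentity.

Lemma homog_even (R : realType) (n d : nat) (p : {mpoly R[n]}) (x : 'I_n -> R) :
  p \is d.-homog -> 0 < p.@[x] -> 0 < p.@[fun i => - x i] -> ~~ odd d.
Proof.
move=> hp px; rewrite -(meval_eq (v1 := fun i => -1 * x i)) => [|i]; last by rewrite mulN1r.
rewrite (meval_dhomog _ _ hp) -signr_odd; case: odd => //.
by rewrite expr1 mulN1r oppr_gt0 => /(lt_trans px); rewrite ltxx.
Qed.

Lemma posdef_diag_gt0 (R : realType) (m : nat) (A : 'M[R]_m) i :
  posdef A -> 0 < A i i.
Proof.
case=> _ /(_ (delta_mx i ord0)); rewrite trmx_delta -rowE -colE !mxE; apply.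
apply/eqP => /matrixP/(_ i ord0)/eqP; rewrite !mxE !eqxx oner_eq0 //.
Qed.

(** Each vector [u r] is charged to the single clique [kap r] containing its support; the vectors
    charged to clique [k] form the rows of [H k]. *)
Lemma sos_clique_decomposition (R : realType) (n m t d : nat)
    (C : 'I_t -> {set 'I_m}) (T : finType) (u : T -> 'I_m -> {mpoly R[n]})
    (kap : T -> 'I_t) :
  (forall r i, u r i \is d.-homog) ->
  (forall r i, u r i != 0 -> i \in C (kap r)) ->
  exists S : forall k : 'I_t, 'M[{mpoly R[n]}]_(#|C k|),
    (forall k, homog_mx (S k) /\ sos_mx (S k)) /\
    \matrix_(i, j) (\sum_r u r i * u r j) =
      \sum_(k < t) (clique_mx _ (C k))^T *m S k *m clique_mx _ (C k).
Proof.
move=> hu su.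
pose H k : 'M[{mpoly R[n]}]_(#|T|, #|C k|) := \matrix_(r, b)
  (if kap (enum_val r) == k then u (enum_val r) (enum_val b) else 0).
exists (fun k => (H k)^T *m H k); split=> [k|].
  split; last by exists #|T|, (H k).
  exists (d + d)%N => i j; rewrite mxE; apply: rpred_sum => r _; rewrite !mxE.
  by case: eqP => _; [exact: dhomogM|rewrite mul0r rpred0].
(* Restricting these rows to the clique and padding with zeros loses nothing. *)
have HE k : H k *m clique_mx _ (C k) =
    \matrix_(r, j) (if kap (enum_val r) == k then u (enum_val r) j else 0).
  apply/matrixP => r j; rewrite !mxE.
  pose h i := (if kap (enum_val r) == k then u (enum_val r) i else 0) * (i == j)%:R.
  transitivity (\sum_(i in C k) h i).
    by rewrite [RHS]big_enum_val; apply: eq_bigr => b _; rewrite !mxE.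
  have [jC|jC] := boolP (j \in C k).
    rewrite (bigD1 j) //= /h eqxx mulr1 big1 ?addr0 // => i /andP[_ /negPf ->].
    by rewrite mulr0.
  rewrite big1 => [|i iC].
    case: eqP => // kk; apply/esym/eqP/negPn/negP => /su; rewrite kk.
    exact/negP.
  by rewrite /h (negPf (_ : i != j)) ?mulr0 //; apply: contraNneq jC => <-.
apply/matrixP => i j; rewrite mxE summxE (partition_big kap predT) //=.
apply: eq_bigr => k _; rewrite -!mulmxA mulmxA -trmx_mul HE mxE.
pose F r := (if kap r == k then u r i else 0) * (if kap r == k then u r j else 0).
transitivity (\sum_(r in T) F r).
  by rewrite big_mkcond; apply: eq_bigr => r _; rewrite /F; case: eqP; rewrite ?mul0r.
by rewrite big_enum_val; apply: eq_bigr => r _; rewrite !mxE.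
Qed.

Lemma maximal_clique_exists (T : finType) (e : rel T) (A : {set T}) :
  is_clique e A -> exists2 B, maximal_clique e B & A \subset B.
Proof. by move/maxset_exists=> [B]; exists B. Qed.

Theorem theorem2p3 (R : realType) (n m t : nat)
    (P : 'M[{mpoly R[n]}]_m) (C : 'I_t -> {set 'I_m})
    (Psym : P^T = P)
    (Phomog : homog_mx P)
    (Pchordal : chordal (sparsity_graph P))
    (C_inj : injective C)
    (C_cliques : forall A : {set 'I_m},
       maximal_clique (sparsity_graph P) A <-> exists k : 'I_t, C k = A)
    (Ppos : forall x : 'rV[R]_n, x != 0 -> posdef (eval_mx P x)) :
  exists (nu : nat) (S : forall k : 'I_t, 'M[{mpoly R[n]}]_(#|C k|)),
    (forall k : 'I_t, homog_mx (S k) /\ sos_mx (S k)) /\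
    sqnorm_mpoly R n ^+ nu *: P =
      \sum_(k < t) (clique_mx _ (C k))^T *m S k *m clique_mx _ (C k).
Proof.
have zero_ok k : homog_mx (0 : 'M[{mpoly R[n]}]_(#|C k|)) /\
    sos_mx (0 : 'M[{mpoly R[n]}]_(#|C k|)).
  split; first by exists 0%N => i j; rewrite mxE rpred0.
  by exists 0%N, 0; rewrite trmx0 mul0mx.
(* Without variables the squared norm is the zero polynomial, so [nu = 1] makes both sides
   vanish. *)
case: n => [|n] in P Psym Phomog Pchordal C_cliques Ppos zero_ok *.
  exists 1%N, (fun k => 0); split=> //.
  rewrite /sqnorm_mpoly big_ord0 expr1 scale0r big1 // => k _.
  by rewrite mulmx0 mul0mx.
case: m => [|m] in P C Psym Phomog Pchordal C_inj C_cliques Ppos zero_ok *.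
  by exists 0%N, (fun k => 0); split=> //; apply/matrixP => -[].
have Psymij i j : P i j = P j i by rewrite -[in LHS]Psym mxE.
case: Phomog => d' Phom.
(* A diagonal entry is positive at a point and at its opposite, which excludes odd degree. *)
have [d d'E] : exists d, d' = (2 * d)%N.
  exists d'./2; rewrite mul2n -[LHS]odd_double_half.
  have pos x : x != 0 -> 0 < (P ord0 ord0).@[(x : 'rV[R]_n.+1) ord0].
    by move=> /Ppos/(posdef_diag_gt0 ord0); rewrite mxE.
  pose x : 'rV[R]_n.+1 := const_mx 1.
  have x0 : x != 0 by apply/eqP => /rowP/(_ ord0)/eqP; rewrite !mxE oner_eq0.
  have := homog_even (Phom ord0 ord0) (pos x x0).
  rewrite (meval_eq (v2 := (- x) ord0)) => [even|i]; last by rewrite [RHS]mxE.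
  by rewrite (negPf (even _)) // pos // oppr_eq0.
have {Phom d' d'E} hP i j : P i j \is (2 * d).-homog by rewrite -d'E.
set e := sparsity_graph P in Pchordal C_cliques.
have esym : ssrbool.symmetric e by move=> i j; rewrite /e /sparsity_graph eq_sym Psymij.
have eirr : irreflexive e by move=> i; rewrite /e /sparsity_graph eqxx.
have [N [N0 dN Qpsd]] := homog_hermite_psd hP Ppos.
have [G [w [a [w0 mean]]]] := reznick_average R n.+1 N0 dN.
pose Q g := map_mx (meval (a g)) (map_mx (homog_hermite d N) P).
have [L QL] : exists L : G -> 'M[R]_m.+1, forall g, Q g = L g *m (L g)^T /\
    forall s i j, i != j -> L g i s != 0 -> L g j s != 0 -> e i j.
  apply: (@fin_all_exists _ (fun=> 'M[R]_m.+1) (fun g L => Q g = L *m L^T /\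
    forall s i j, i != j -> L i s != 0 -> L j s != 0 -> e i j)) => g.
  apply: psd_chordal_factor => // [||i j ij].
    by apply/matrixP => i j; rewrite !mxE Psymij.
    exact: Qpsd.
  (* By linearity [homog_hermite] sends a zero entry of [P] to zero, so the sparsity pattern is
     inherited. *)
  by rewrite !mxE /e /sparsity_graph ij; apply: contraNneq => ->; rewrite linear0 meval0.
(* One vector for each node and each column of its Cholesky factor; the products [u r i * u r j] add
   up to the averaged sum. *)
pose u (r : G * 'I_m.+1) i : {mpoly R[n.+1]} :=
  (Num.sqrt (w r.1) * L r.1 i r.2) *: linform (a r.1) ^+ N.
have hu r i : u r i \is N.-homog.
  by have := dhomogMn N (dhomog_linform (a r.1)); rewrite mul1n; exact: rpredZ.
have [kap kapP] : exists kap : G * 'I_m.+1 -> 'I_t,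
    forall r i, u r i != 0 -> i \in C (kap r).
  apply: (@fin_all_exists _ (fun=> 'I_t) (fun r k => forall i, u r i != 0 -> i \in C k)) => r.
  (* The support of a column of [L] is a clique, hence inside some maximal clique. *)
  pose A := [set i | L r.1 i r.2 != 0].
  have Acl : is_clique e A.
    apply/forall_inP => i; rewrite inE => Li; apply/forall_inP => j; rewrite inE => Lj.
    by apply/implyP => ij; exact: (QL r.1).2 Lj.
  have [B /C_cliques[k <-] /subsetP AB] := maximal_clique_exists Acl.
  exists k => i ui; apply: AB; rewrite inE; apply: contraNneq ui => Li.
  by rewrite /u Li mulr0 scale0r.
have [S [S_ok SE]] := sos_clique_decomposition hu kapP.
exists (N - d)%N, S; split=> //; rewrite -SE; apply/matrixP => i j; rewrite !mxE.
apply/eqP; rewrite -subr_eq0; apply/eqP.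
(* Both sides are forms of degree [N + N], so it is enough to compare values, which [mean]
   computes. *)
have hdeg : (2 * (N - d) + 2 * d = N + N)%N by lia.
apply: (@dhomog_meval_eq0 _ _ (N + N)) => [|x].
  apply: rpredB; last by apply: rpred_sum => r _; exact: dhomogM.
  by rewrite -hdeg; apply: dhomogM => //; exact: dhomogMn (dhomog_sqnorm _ _).
apply/eqP; rewrite mevalB subr_eq0 mevalM rmorphXn /=.
have -> : (sqnorm_mpoly R n.+1).@[x] = \sum_i x i ^+ 2.
  by rewrite /sqnorm_mpoly raddf_sum; apply: eq_bigr => l _; rewrite /= rmorphXn /= mevalXU.
rewrite [in X in _ == X]raddf_sum mulrC -mean //.
rewrite -(pair_bigA _ (fun g s => (u (g, s) i * u (g, s) j).@[x])) /=.
apply/eqP; apply: eq_bigr => g _.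
have -> : (homog_hermite d N (P i j)).@[a g] = \sum_s L g i s * L g j s.
  have /matrixP/(_ i j) := (QL g).1; rewrite !mxE => ->.
  by apply: eq_bigr => s _; rewrite mxE.
rewrite mulr_suml mulr_sumr; apply: eq_bigr => s _.
have lx : (linform (a g)).@[x] = \sum_l x l * a g l.
  rewrite /linform raddf_sum; apply: eq_bigr => l _ /=.
  by rewrite mevalZ mevalXU mulrC.
rewrite mevalM !mevalZ !rmorphXn /= lx mulnC exprM.
rewrite -[w g in LHS]sqr_sqrtr ?w0 //; ring.
Qed.
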